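(* Let $X$ be a compact connected $1$-complex with $\partial X=\emptyset$, and let $\mathsf{A}=\{\mathsf{A}_{\{i\}}\}$, $i=1,\dots,n$, be a random good covering of $X$. Put $|\mathsf{A}|=\bigcup_{i}\mathsf{A}_{\{i\}}$ and let $\boldsymbol{\chi}=\boldsymbol{\chi}(\mathsf{A})=\chi(\mathcal{N}(\mathsf{A}))$ be the random Euler characteristic of the nerve. Then the range of $\boldsymbol{\chi}(\mathsf{A})$ can be restricted to $$\underline{m}=\chi(X)\leq\boldsymbol{\chi}(\mathsf{A})\leq n=\overline{m},$$ and the complete coverage probability equals $$\mathbb{P}(X\subseteq|\mathsf{A}|)=\mathbb{P}\bigl(\boldsymbol{\chi}(\mathsf{A})=\chi(X)\bigr)=\sum_{s\in\mathfrak{C}_n;\ \chi(s)=\chi(X)}P_s=\sum_{s\in\mathfrak{C}_n}a_s(\boldsymbol{\chi})\,p_s,$$ where $$a_s(\boldsymbol{\chi})=\sum_{k=0}^{N}v_k(\boldsymbol{\chi})\,c_{s,k}(\boldsymbol{\chi}),\qquad N=\overline{m}-\underline{m},$$ $$v_k(\boldsymbol{\chi})=\frac{(-1)^k}{N!}\sum_{\underline{m}<j_1<j_2<\dots<j_{N-k}\leq\overline{m}}j_1j_2\cdots j_{N-k},\qquad v_N(\boldsymbol{\chi})=\frac{(-1)^N}{N!}$$ (the $j_l$ are integers), and $$c_{s,k}(\boldsymbol{\chi})=\sum_{i=0}^{r^+_{top}(s)}\ \sum_{j=0}^{r^-_{top}(s)}(-1)^{r_{top}(s)-i-j}\binom{r^+_{top}(s)}{i}\binom{r^-_{top}(s)}{j}\Bigl(i-j+r^+_{low}(s)-r^-_{low}(s)\Bigr)^k\quad\text{if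 }k\ge r(s),$$ $$c_{s,k}(\boldsymbol{\chi})=0\quad\text{if }k<r(s),$$ where $r(s)$ is the number of all faces of $s$. If the diameter of the $\mathsf{A}_{\{i\}}$ is almost surely smaller than $\tfrac16\mathcal{C}$, where $\mathcal{C}$ is the length of the shortest cycle in $X$ (the girth), then $p_s$ further simplifies as $$p_s=\mathbb{P}\bigl(\mathsf{A}_{\{i\}}\cap\mathsf{A}_{\{j\}}\neq\emptyset\ \text{for all }(i,j)\in E(s),\ i<j\bigr),$$ where $E(s)$ is the edge set of $s$.
   Context: A compact connected $1$-complex $X$ is a connected space homeomorphic to a finite multigraph, equipped with the intrinsic distance $d_X(x,y)$ = length of a shortest path from $x$ to $y$; diameters are taken with respect to $d_X$. $\partial X$ is the set of leaf vertices of $X$. Random covering: $(\Omega,\sigma,\mathbb{P})$ is a probability space and each $\mathsf{A}_{\{i\}}$ is a measurable map from $\Omega$ to $\mathcal{C}(X)\sqcup\{\emptyset\}$, where $\mathcal{C}(X)$ is the set of nonempty compact subsets of $X$ with the Hausdorff distance and its Borel $\sigma$-algebra; the value $\emptyset$ is allowed. A covering is just such a finite family; its union need not be $X$. No a priori assumption is made on the distribution of $\mathsf{A}$. The covering is good if almost surely each intersection $\bigcap_{i\in I}\mathsf{A}_{\{i\}}$, $\emptyset\ne I\subseteq\{1,\dots,n\}$ (including single sets), is contractible whenever it is nonempty. Complexes: $\mathfrak{C}_n$ is the set of labeled abstract subcomplexes of the full simplex with vertices $1,\dots,n$, together with the empty complex; an element $s$ is identified with the family of all its faces, which are nonempty subsets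 of $\{1,\dots,n\}$. A face $I$ has dimension $|I|-1$, and $\chi(s)=\sum_{I\in s}(-1)^{|I|-1}$. The nerve $\mathcal{N}(\mathsf{A})$ is the random element of $\mathfrak{C}_n$ whose faces are the nonempty $I$ with $\bigcap_{i\in I}\mathsf{A}_{\{i\}}\ne\emptyset$. For $s\in\mathfrak{C}_n$, $$p_s=\mathbb{P}\Bigl(\forall I\in s:\ \bigcap_{i\in I}\mathsf{A}_{\{i\}}\neq\emptyset\Bigr),\qquad P_s=\mathbb{P}\Bigl(\forall I\in s:\ \bigcap_{i\in I}\mathsf{A}_{\{i\}}\neq\emptyset,\ \ \forall J\notin s:\ \bigcap_{j\in J}\mathsf{A}_{\{j\}}=\emptyset\Bigr),$$ where $J$ ranges over nonempty subsets of $\{1,\dots,n\}$; that is, $p_s=\mathbb{P}(s\subseteq\mathcal{N}(\mathsf{A}))$ and $P_s=\mathbb{P}(\mathcal{N}(\mathsf{A})=s)$. Face counts: a top face (facet) of $s$ is a face maximal under inclusion; a lower face is a face that is not a top face. $r^+_{top}(s)$, $r^-_{top}(s)$ are the numbers of even-dimensional, respectively odd-dimensional, top faces of $s$; $r_{top}(s)=r^+_{top}(s)+r^-_{top}(s)$; $r^+_{low}(s)$, $r^-_{low}(s)$ are the numbers of even-, respectively odd-dimensional lower faces of $s$. Convention: $0^0=1$.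
   Formalization: The English fails in three places: c_{s,k} vanishes for k below the number of top faces, not of all faces; if χ(X)≥0 the union |A| is assumed a.s. nonempty for the range and coverage claims; in the last formula A_{i} is assumed a.s. nonempty for isolated vertices i of s. *)

(* Defs.v *)
From HB Require Import structures.
From mathcomp Require Import all_boot all_order all_algebra.
From mathcomp Require Import all_classical all_reals all_analysis.
Set Implicit Arguments.
Unset Strict Implicit.
Unset Printing Implicit Defensive.
Import Order.TTheory GRing.Theory Num.Theory.
Import numFieldNormedType.Exports.
Local Open Scope classical_set_scope.
Local Open Scope ring_scope.

(* A compact 1-complex with its intrinsic distance is given by a finite       *)
(* multigraph (loops and parallel edges allowed) with edge lengths, and is    *)
(* realized as a pseudometric space below.                                    *)
Record multigraph (R : realType) := Multigraph {
  vertex : finType;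
  edge : finType;
  src : edge -> vertex;
  tgt : edge -> vertex;
  len : edge -> R;
  len_gt0 : forall e, 0 < len e }.

Section realization.
Context {R : realType} (G : multigraph R).

(* A point is a vertex, or a pair (e, t) with 0 < t < len e: the interior     *)
(* point of e at distance t from src e along e.                               *)
Definition is_point (p : vertex G + edge G * R) : bool :=
  if p is inr (e, t) then 0 < t < len e else true.

Definition realization : Type := {p : vertex G + edge G * R | is_point p}.

HB.instance Definition _ := Choice.on realization.

(* x has coordinate t on the closed edge e. The vertex of a loop has the two  *)
(* coordinates 0 and len e on that loop.                                      *)
Definition has_coord (e : edge G) (t : R) (x : realization) : Prop :=
  match val x with
  | inl v => (t = 0 /\ v = src e) \/ (t = len e /\ v = tgt e)
  | inr (e', t') => e = e' /\ t = t'
  end.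

(* is_path x y l: some path from x to y, made of finitely many segments each  *)
(* contained in one closed edge, has length l.                                *)
Inductive is_path : realization -> realization -> R -> Prop :=
| path_nil x : is_path x x 0
| path_cons x y z e t u l : has_coord e t x -> has_coord e u y ->
    is_path y z l -> is_path x z (`|t - u| + l).

Lemma is_path_cat x y z l1 l2 :
  is_path x y l1 -> is_path y z l2 -> is_path x z (l1 + l2).
Proof.
elim=> [{}x|{}x y' z' e t u l xt yu _ IH] yz; first by rewrite add0r.
by rewrite -addrA; apply: path_cons xt yu _; exact: IH.
Qed.

Lemma is_path_sym x y l : is_path x y l -> is_path y x l.
Proof.
elim=> [{}x|{}x y' z e t u {}l xt yu _ IH]; first exact: path_nil.
rewrite addrC; apply: is_path_cat IH _.
rewrite distrC -[X in is_path _ _ X]addr0.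
by apply: path_cons yu xt _; exact: path_nil.
Qed.

Lemma is_path_ge0 x y l : is_path x y l -> 0 <= l.
Proof. by elim=> // *; rewrite addr_ge0. Qed.

Definition path_ball (x : realization) (r : R) (y : realization) : Prop :=
  exists2 l, is_path x y l & l < r.

Let path_ball_center x r : 0 < r -> path_ball x r x.
Proof. by exists 0 => //; exact: path_nil. Qed.

Let path_ball_sym x y r : path_ball x r y -> path_ball y r x.
Proof. by case=> l xy lr; exists l => //; exact: is_path_sym. Qed.

Let path_ball_triangle x y z r1 r2 :
  path_ball x r1 y -> path_ball y r2 z -> path_ball x (r1 + r2) z.
Proof.
case=> l1 xy l1r [l2 yz l2r]; exists (l1 + l2); last exact: ltrD.
exact: is_path_cat xy yz.
Qed.

HB.instance Definition _ :=
  hasNbhs.Build realization (nbhs_ (entourage_ path_ball)).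
HB.instance Definition _ := @Nbhs_isPseudoMetric.Build R realization
  (entourage_ path_ball) erefl path_ball
  path_ball_center path_ball_sym path_ball_triangle erefl.

(* The library distance edist of the realization is the intrinsic distance.   *)
Lemma edist_realization (x y : realization) :
  edist (x, y) = ereal_inf [set l%:E | l in is_path x y].
Proof.
apply/eqP; rewrite eq_le; apply/andP; split.
- apply: le_ereal_inf_tmp => _ [l xyl <-].
  apply/lee_addgt0Pr => e e0; apply: ereal_inf_lbound.
  exists (l + e) => //; split => /=.
    by rewrite ltr_wpDl// (is_path_ge0 xyl).
  by exists l => //; rewrite ltrDl.
- apply: le_ereal_inf_tmp => _ [r [_ [l xyl lr]] <-].
  apply: (@le_trans _ _ l%:E); last by rewrite lee_fin ltW.
  by apply: ereal_inf_lbound; exists l.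
Qed.

Definition degree (v : vertex G) : nat :=
  (#|[set e | src e == v]%SET| + #|[set e | tgt e == v]%SET|)%N.

Definition leaves : {set vertex G} := [set v | degree v == 1%N]%SET.

Definition graph_euler : int := #|vertex G|%:Z - #|edge G|%:Z.

(* An oriented edge is (e, b), traversed backwards if b is true.              *)
Definition osrc (d : edge G * bool) := if d.2 then tgt d.1 else src d.1.
Definition otgt (d : edge G * bool) := if d.2 then src d.1 else tgt d.1.

(* A loop is a cycle with one edge, two parallel edges form a cycle with two  *)
(* edges.                                                                     *)
Definition is_cycle (c : seq (edge G * bool)) : bool :=
  [&& c != [::], path.cycle (fun d d' => otgt d == osrc d') c,
      uniq [seq d.1 | d <- c] & uniq [seq osrc d | d <- c]].

(* +oo if there is no cycle. *)
Definition girth : \bar R :=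
  ereal_inf [set (\sum_(d <- c) len d.1)%:E | c in [set c | is_cycle c]].

End realization.

Definition contractible (R : realType) (T : topologicalType) (A : set T) :=
  exists2 a : T, A a & exists H : T * R -> T,
    [/\ {within A `*` `[0, 1], continuous H},
        (forall x t, A x -> 0 <= t <= 1 -> A (H (x, t))),
        (forall x, A x -> H (x, 0) = x) &
        (forall x, A x -> H (x, 1) = a)].

Section hyperspace.
Context {R : realType} (X : pseudoMetricType R).

(* -oo for the empty set. *)
Definition diam (A : set X) : \bar R :=
  ereal_sup [set edist xy | xy in A `*` A].

Definition hausdorff_dist (K L : set X) : \bar R :=
  maxe (ereal_sup [set edist_inf L x | x in K])
       (ereal_sup [set edist_inf K y | y in L]).

(* The nonempty compact subsets of X, together with the empty set. *)
Definition hyperspace : Type := {K : set X | `[< compact K >]}.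
HB.instance Definition _ := Choice.on hyperspace.

Definition hyperspace0 : hyperspace := exist _ set0 (introT (asboolP _) compact0).
HB.instance Definition _ := isPointed.Build hyperspace hyperspace0.

(* Open sets of the disjoint union of the Hausdorff metric topology on the    *)
(* nonempty compact sets and of an isolated point for the empty set.          *)
Definition hausdorff_open : set (set hyperspace) :=
  [set U | forall K, U K -> val K !=set0 ->
     exists2 e : R, 0 < e & forall L : hyperspace, val L !=set0 ->
       (hausdorff_dist (val K) (val L) < e%:E)%E -> U L].

Definition borel_hyperspace := g_sigma_algebraType hausdorff_open.

End hyperspace.

Section complexes.
Context {n : nat}.
Implicit Types (s : {set {set 'I_n}}) (I J : {set 'I_n}).

(* Labels 1, ..., n are encoded as 'I_n. A complex need not contain all the   *)
(* vertices.                                                                  *)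
Definition is_complex s : bool :=
  (finset.set0 \notin s) &&
  [forall I in s, forall J : {set 'I_n},
     (J != finset.set0) && (J \subset I) ==> (J \in s)].

Definition faces_euler s : int := \sum_(I in s) (-1) ^+ #|I|.-1.

Definition top_faces s : {set {set 'I_n}} := [set I | maxset (mem s) I]%SET.
Definition low_faces s : {set {set 'I_n}} := (s :\: top_faces s)%SET.

(* Even-dimensional faces have odd cardinality. *)
Definition even_faces s : {set {set 'I_n}} := [set I in s | odd #|I|]%SET.
Definition odd_faces s : {set {set 'I_n}} := [set I in s | ~~ odd #|I|]%SET.

Definition rtop s : nat := #|top_faces s|.
Definition rtop_even s : nat := #|even_faces (top_faces s)|.
Definition rtop_odd s : nat := #|odd_faces (top_faces s)|.
Definition rlow_even s : nat := #|even_faces (low_faces s)|.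
Definition rlow_odd s : nat := #|odd_faces (low_faces s)|.

(* Signed count of the words of length k in the faces of s that use every top *)
(* face of s. Such words exist only if k is at least the number of top faces; *)
(* below this bound the double sum vanishes as well. The bound cannot be      *)
(* replaced by the total number of faces of s: for s the closure of one edge  *)
(* (three faces, one of them top) and k = 1 the value is -1.                  *)
Definition c_coef s (k : nat) : int :=
  if (k < rtop s)%N then 0 else
  \sum_(0 <= i < (rtop_even s).+1) \sum_(0 <= j < (rtop_odd s).+1)
    (-1) ^+ (rtop s - i - j)%N *
    'C(rtop_even s, i)%:Z * 'C(rtop_odd s, j)%:Z *
    (i%:Z - j%:Z + (rlow_even s)%:Z - (rlow_odd s)%:Z) ^+ k.

End complexes.

Section coefficients.
Context {R : realType} (lo hi : int).

Definition range_len : nat := `|hi - lo|%N.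

(* The integers j with lo < j <= hi are lo + l + 1 with l < hi - lo, and an   *)
(* increasing (N-k)-tuple of them is encoded as a set of N-k indices l.       *)
Definition v_coef (k : nat) : R :=
  (-1) ^+ k / (range_len`!)%:R *
  \sum_(J : {set 'I_range_len} | #|J| == (range_len - k)%N)
    \prod_(l in J) (lo + (l : nat)%:Z + 1)%:~R.

Definition a_coef (n : nat) (s : {set {set 'I_n}}) : R :=
  \sum_(0 <= k < range_len.+1) v_coef k * (c_coef s k)%:~R.

End coefficients.

Section coverings.
Context {n : nat} {T : Type}.

Definition inter (B : 'I_n -> set T) (I : {set 'I_n}) : set T :=
  \bigcap_(i in [set` I]) B i.

Definition nerve (B : 'I_n -> set T) : {set {set 'I_n}} :=
  [set I | (I != finset.set0) && `[< inter B I !=set0 >]]%SET.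

Lemma nerve_is_complex (B : 'I_n -> set T) : is_complex (nerve B).
Proof.
apply/andP; split; first by rewrite inE eqxx.
apply/forallP => I; apply/implyP; rewrite inE => /andP[_ /asboolP[x xI]].
apply/forallP => J; apply/implyP => /andP[J0 JI]; rewrite inE J0.
by apply/asboolP; exists x => i /= iJ; apply: xI; rewrite /=; exact: (fintype.subsetP JI).
Qed.

End coverings.

Section random_coverings.
Context {d : measure_display} {W : measurableType d} {R : realType}
  (P : probability W R) {X : pseudoMetricType R} {n : nat}
  (A : 'I_n -> W -> hyperspace X).

Definition covering_at (w : W) : 'I_n -> set X := fun i => val (A i w).

Definition random_covering : Prop :=
  forall i, measurable_fun setT (A i : W -> borel_hyperspace X).

Definition good_covering : Prop :=
  {ae P, forall w, forall I : {set 'I_n}, I != finset.set0 ->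
     inter (covering_at w) I !=set0 ->
     contractible R (inter (covering_at w) I)}.

Definition chi_nerve (w : W) : int := faces_euler (nerve (covering_at w)).

Definition p_sub (s : {set {set 'I_n}}) : \bar R :=
  P [set w | forall I, I \in s -> inter (covering_at w) I !=set0].

Definition P_eq (s : {set {set 'I_n}}) : \bar R :=
  P [set w | (forall I, I \in s -> inter (covering_at w) I !=set0) /\
             (forall J, J != finset.set0 -> J \notin s ->
                inter (covering_at w) J = set0)].

End random_coverings.

(* Main.v *)
Require Import Defs.
From HB Require Import structures.
From mathcomp Require Import all_boot all_order all_algebra.
From mathcomp Require Import all_classical all_reals all_analysis.
From mathcomp Require Import ring lra zify.
Set Implicit Arguments.
Unset Strict Implicit.
Unset Printing Implicit Defensive.
Import Order.TTheory GRing.Theory Num.Theory.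
Import numFieldNormedType.Exports.
Local Open Scope classical_set_scope.
Local Open Scope ring_scope.

(** Coverage is read off from the Euler characteristic of the nerve in three
    steps.

    Geometry. A connected closed set meets each edge in finitely many intervals
    (connected_tame), so that all edges can be subdivided into cells in such a
    way that every covering set is a union of nodes and closed cells. Let chi be
    the number of nodes minus the number of cells in a set; it is a signed count
    of sample points and satisfies inclusion-exclusion. A contractible union of
    cells is a tree, with chi equal to 1: it is connected (chi_connected), and
    each of its cells is the coboundary of a function on its nodes
    (contractible_has_cuts), hence the rank of its incidence matrix gives its
    numbers of nodes and cells. The required function counts how often the
    contraction moves a point through the middle of the cell; it is well defined
    because a closed path shorter than all cycles of the graph crosses every
    point with total sign 0 (short_loop_crossings). Hence the Euler
    characteristic of the nerve of a good covering is chi of its union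
    (chi_nerve_union). The upper bound n follows by adding one covering set at a
    time, since a union of cells inside a tree is a forest and has chi at least 0
    (chi_union_le). For the lower bound, let Z be the complement of a union that
    is neither empty nor everything. Without leaves each node of Z meets at
    least two cells, all of them in Z, and by connectedness some cell of Z has an
    end outside Z; counting ends of cells gives chi Z < 0 (chi_proper_gt). So the
    lower end of the range is attained exactly for complete coverage.

    Algebra. The indicator of the lower end of the range is a Lagrange polynomial
    in the Euler characteristic, with coefficients v_k (v_coef_indicator). The
    k-th power of the Euler characteristic of a complex is a signed count of
    words of k faces; sorting the words by the complex that they generate gives
    the coefficients c_(s,k) (c_coef_words, sum_c_coef). Taking expectations
    turns the polynomial into the sum of a_s p_s (sum_a_coef).

    Small sets. Let three sets of diameter less than a sixth of the girth
    intersect in pairs. Their union lies in a ball of radius less than half the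
    girth, where the crossings of short paths from the centre again make every
    cell a coboundary, so chi of the union is at least 1; if the three sets had
    no common point, inclusion-exclusion would give 0 (helly_three). Induction
    extends this to any number of sets (pairwise_intersecting), and the faces of
    the nerve are determined by its edges.

    All events are measurable because a compact set meets a ball under an open
    condition for the Hausdorff distance, and the points with rational
    coordinates are dense. *)

(** * Signed counts of subsets *)

Section signed_counts.
Variable (T : finType).

Lemma sum_signs_subsets (J : {set T}) :
  \sum_(I : {set T} | I \subset J) (-1) ^+ #|I| = (J == finset.set0)%:R :> int.
Proof.
have := @bigA_distr int 0 1 *%R +%R T (fun i => - (i \in J)%:R) (fun=> 1).
have -> : \prod_i (- (i \in J)%:R + 1) = (J == finset.set0)%:R :> int.
  have [->|/set0Pn[i iJ]] := eqVneq J finset.set0.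
    by rewrite big1// => i _; rewrite inE oppr0 add0r.
  by rewrite (bigD1 i)//= iJ addNr mul0r.
move=> ->; rewrite [RHS]big_mkcond [LHS]big_mkcond /=.
apply: eq_bigr => I _; rewrite -big_mkcond /=.
case: ifPn => [/fintype.subsetP IJ|/subsetPn[i iI iJ]].
  rewrite (eq_bigr (fun=> -1)) ?prodr_const// => i iI.
  by rewrite (IJ _ iI).
by rewrite (bigD1 i)//= (negbTE iJ) oppr0 mul0r.
Qed.

Lemma sum_euler_subsets (J : {set T}) :
  \sum_(I : {set T} | (I != finset.set0) && (I \subset J)) (-1) ^+ #|I|.-1 =
  (J != finset.set0)%:R :> int.
Proof.
have := sum_signs_subsets J; rewrite (bigD1 finset.set0) ?finset.sub0set//=.
rewrite finset.cards0 expr0.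
under eq_bigl do rewrite andbC.
rewrite [X in 1 + X](_ : _ = - \sum_(I : {set T} | (I != finset.set0) && (I \subset J))
  (-1) ^+ #|I|.-1); last first.
  rewrite -sumrN; apply: eq_bigr => I /andP[I0 _].
  rewrite -[in LHS](prednK (_ : 0 < #|I|)%N) ?card_gt0//.
  by rewrite exprS mulN1r.
move=> /eqP; rewrite subr_eq addrC -subr_eq => /eqP <-.
by case: eqP => _; rewrite ?subrr ?subr0.
Qed.

Lemma sum_subsets_by_card (E : {set T}) (h : nat -> int) :
  \sum_(U : {set T} | U \subset E) h #|U| =
  \sum_(0 <= i < #|E|.+1) 'C(#|E|, i)%:Z * h i.
Proof.
rewrite big_mkord (partition_big (fun U : {set T} => inord #|U| : 'I_#|E|.+1) predT)//=.
apply: eq_bigr => i _.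
rewrite (eq_bigr (fun=> h i)); last first.
  move=> U /andP[UE /eqP <-]; rewrite inordK// ltnS; exact: subset_leq_card.
rewrite sumr_const -mulr_natl; congr (_ * _).
rewrite -(cards_draws E i) natz; congr (Posz _).
rewrite -[LHS]sum1_card -[RHS]sum1_card; apply: eq_bigl => U; rewrite !inE.
rewrite -[LHS]/((U \subset E) && (inord #|U| == i)).
case: (boolP (U \subset E)) => //= UE.
by rewrite -val_eqE/= inordK// ltnS; exact: subset_leq_card.
Qed.

(** This turns a sum over sets of top faces into the double sum over i and j of
    the coefficients: there the part a consists of the even-dimensional faces. *)
Lemma sum_subsets_by_two_cards (S : {set T}) (a : pred T) (h : nat -> nat -> int) :
  \sum_(U : {set T} | U \subset S)
     h #|[set x in U | a x]%SET| #|[set x in U | ~~ a x]%SET| =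
  \sum_(0 <= i < #|[set x in S | a x]%SET|.+1)
   \sum_(0 <= j < #|[set x in S | ~~ a x]%SET|.+1)
    'C(#|[set x in S | a x]%SET|, i)%:Z * 'C(#|[set x in S | ~~ a x]%SET|, j)%:Z * h i j.
Proof.
set E := [set x in S | a x]%SET; set O := [set x in S | ~~ a x]%SET.
transitivity (\sum_(U : {set T} | U \subset E) \sum_(V : {set T} | V \subset O)
   h #|U| #|V|).
  rewrite pair_big/=.
  rewrite (reindex_onto (fun p : {set T} * {set T} => (p.1 :|: p.2)%SET)
     (fun U => ([set x in U | a x]%SET, [set x in U | ~~ a x]%SET))); last first.
    by move=> U _; apply/setP => x; rewrite !inE; case: (x \in U); case: (a x).
  apply: eq_big => [[U V]|[U V]] /=; last first.
    by move=> /andP[_ /eqP[-> ->]].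
  apply/andP/andP => [[/fintype.subsetP US /eqP[UE VE]]|[/fintype.subsetP UE /fintype.subsetP VO]].
    by split; apply/fintype.subsetP => x; [rewrite -UE|rewrite -VE];
      rewrite inE => /andP[/US xS ax]; rewrite inE xS.
  split.
    apply/fintype.subsetP => x; rewrite inE => /orP[/UE|/VO]; by rewrite inE => /andP[].
  apply/eqP; congr pair; apply/setP => x; rewrite !inE.
    case xU : (x \in U) => /=; first by have := UE _ xU; rewrite inE => /andP[].
    by case xV : (x \in V) => //=; have := VO _ xV; rewrite inE => /andP[_ /negbTE].
  case xV : (x \in V) => /=; first by have := VO _ xV; rewrite orbT inE => /andP[].
  by case xU : (x \in U) => //=; have := UE _ xU; rewrite inE => /andP[_ ->].
rewrite (eq_bigr (fun U : {set T} => \sum_(0 <= j < #|O|.+1) 'C(#|O|, j)%:Z * h #|U| j));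
  last by move=> U _; exact: (sum_subsets_by_card O (h #|U|)).
rewrite (sum_subsets_by_card E (fun i => \sum_(0 <= j < #|O|.+1) 'C(#|O|, j)%:Z * h i j)).
by apply: eq_bigr => i _; rewrite mulr_sumr; apply: eq_bigr => j _; rewrite mulrA.
Qed.

End signed_counts.

(** * The coefficients as signed counts of words of faces *)

Section coefficient_identity.
Variable n : nat.
Implicit Types (s N Z : {set {set 'I_n}}).

Let sgn (I : {set 'I_n}) : int := (-1) ^+ #|I|.-1.

Lemma faces_euler_split (S : {set {set 'I_n}}) : finset.set0 \notin S ->
  faces_euler S = #|even_faces S|%:Z - #|odd_faces S|%:Z.
Proof.
move=> S0; rewrite /faces_euler (bigID (fun I : {set 'I_n} => odd #|I|))/=.
have card_pos I : I \in S -> (0 < #|I|)%N.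
  by move=> IS; rewrite card_gt0; apply: contraNneq S0 => <-.
congr (_ + _).
  rewrite (eq_bigr (fun=> 1)); last first.
    move=> I /andP[/card_pos I0 oI]; rewrite -signr_odd.
    by move: oI; rewrite -[X in odd X](prednK I0)/= => /negbTE ->.
  by rewrite sumr_const natz; congr Posz; apply: eq_card => I; rewrite !inE.
rewrite (eq_bigr (fun=> -1)); last first.
  move=> I /andP[/card_pos I0 oI]; rewrite -signr_odd.
  by move: oI; rewrite -[X in odd X](prednK I0)/= negbK => ->.
rewrite sumr_const mulNrn; congr (- _).
by rewrite natz; congr Posz; apply: eq_card => I; rewrite !inE.
Qed.

Lemma top_faces_sub s : top_faces s \subset s.
Proof. by apply/fintype.subsetP => I; rewrite inE => /maxsetp. Qed.

(** The base of the power in the double sum is the Euler characteristic of the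
    set of all low faces and of i even-dimensional and j odd-dimensional top
    faces. *)
Lemma c_coef_subsets s k : finset.set0 \notin s -> (rtop s <= k)%N ->
  c_coef s k = \sum_(U : {set {set 'I_n}} | U \subset top_faces s)
    (-1) ^+ (rtop s - #|U|) * faces_euler (U :|: low_faces s) ^+ k.
Proof.
move=> s0 sk; rewrite /c_coef ltnNge sk/=.
pose h i j : int := (-1) ^+ (rtop s - i - j)%N *
  (i%:Z - j%:Z + (rlow_even s)%:Z - (rlow_odd s)%:Z) ^+ k.
transitivity (\sum_(U : {set {set 'I_n}} | U \subset top_faces s)
   h #|even_faces U| #|odd_faces U|); last first.
  apply: eq_bigr => U Utop; rewrite /h.
  have Us : U \subset s := fintype.subset_trans Utop (top_faces_sub s).
  have U0 : finset.set0 \notin U by apply: contra s0; exact: (fintype.subsetP Us).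
  have L0 : finset.set0 \notin low_faces s by rewrite inE (negbTE s0) andbF.
  have -> : (rtop s - #|even_faces U| - #|odd_faces U|)%N = (rtop s - #|U|)%N.
    rewrite -subnDA; congr (_ - _)%N.
    rewrite -(cardsID [set I : {set 'I_n} | odd #|I|]%SET U); congr (_ + _)%N; apply: eq_card => I;
      by rewrite !inE// andbC.
  congr (_ * _ ^+ _).
  have -> : faces_euler (U :|: low_faces s) = faces_euler U + faces_euler (low_faces s).
    rewrite /faces_euler -bigU/=; first by apply: eq_bigl => I; rewrite !inE.
    rewrite disjoint_subset; apply/fintype.subsetP => I IU; rewrite !inE.
    by move: (fintype.subsetP Utop _ IU); rewrite inE => ->.
  rewrite !faces_euler_split//.
  by rewrite /rlow_even /rlow_odd addrA.
rewrite (sum_subsets_by_two_cards (top_faces s) (fun I => odd #|I|) h).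
apply: eq_bigr => i _; apply: eq_bigr => j _; rewrite /h.
rewrite -/(even_faces (top_faces s)) -/(odd_faces (top_faces s)).
rewrite /rtop_even /rtop_odd; move: (_ ^+ k) ((-1) ^+ _) => u v.
by rewrite -!mulrA mulrCA; congr (_ * _); rewrite mulrCA.
Qed.

(** A set of top faces can be complemented inside S, which turns the sum into
    the alternating sum over the subsets of S minus Z. *)
Lemma sum_missing_subsets (S Z : {set {set 'I_n}}) :
  \sum_(U : {set {set 'I_n}} | (U \subset S) && (S :&: Z \subset U))
    (-1) ^+ (#|S| - #|U|) = (S \subset Z)%:R :> int.
Proof.
have -> : S \subset Z = (S :\: Z == finset.set0) by rewrite finset.setD_eq0.
rewrite -sum_signs_subsets.
rewrite (reindex_onto (fun U => S :\: U)%SET (fun U => S :\: U)%SET)/=; last first.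
  by move=> U /andP[US _]; rewrite finset.setDDr finset.setDv finset.set0U; exact/finset.setIidPr.
apply: eq_big => [U|U /andP[/andP[US SZU] /eqP SSU]]; last first.
  rewrite cardsD subKn ?subset_leq_card ?subsetIl// -SSU; congr (_ ^+ _).
  by congr #|pred_of_set _|; rewrite finset.setDDr finset.setDv finset.set0U finset.setIA finset.setIid.
apply/idP/idP.
  move=> /andP[/andP[_ /fintype.subsetP H] /eqP E]; apply/fintype.subsetP => I IU.
  move: (IU); rewrite -{1}E !inE => /andP[IUS IS]; rewrite IS andbT.
  by apply: contraTN IU => IZ; have := H I; rewrite !inE IS IZ => /(_ isT)/andP[].
move=> /fintype.subsetP USZ; rewrite finset.subsetDl/=; apply/andP; split.
  apply/fintype.subsetP => I; rewrite !inE => /andP[IS IZ]; rewrite IS andbT.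
  by apply/negP => /USZ; rewrite inE IZ.
rewrite finset.setDDr finset.setDv finset.set0U; apply/eqP/finset.setIidPr.
by apply/fintype.subsetP => I /USZ; rewrite inE => /andP[].
Qed.

Lemma faces_euler_pow (S : {set {set 'I_n}}) k :
  faces_euler S ^+ k = \sum_(h : {ffun 'I_k -> {set 'I_n}})
    (\prod_j sgn (h j)) * (h @: 'I_k \subset S)%:R.
Proof.
rewrite -[X in _ ^+ X]card_ord -prodr_const /faces_euler.
under eq_bigr do rewrite big_mkcond/=.
rewrite bigA_distr_bigA/=; apply: eq_bigr => h _.
case: (boolP (_ \subset _)) => [/fintype.subsetP hS|/subsetPn[I /imsetP[j _ ->] hjS]].
  rewrite mulr1; apply: eq_bigr => j _.
  by rewrite hS//; apply/imsetP; exists j.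
by rewrite mulr0 (bigD1 j)//= (negbTE hjS) mul0r.
Qed.

(** Expanding the powers in the coefficient, the alternating sum over the sets
    of top faces keeps exactly the words whose letters are faces of the complex
    and among which all its top faces occur. *)
Lemma c_coef_words s k : finset.set0 \notin s ->
  c_coef s k = \sum_(h : {ffun 'I_k -> {set 'I_n}})
    (\prod_j sgn (h j)) *
    ((h @: 'I_k \subset s) && (top_faces s \subset h @: 'I_k))%:R.
Proof.
move=> s0; have [ks|sk] := ltnP k (rtop s).
  (* A word of k letters cannot contain more than k top faces. *)
  rewrite /c_coef ks big1// => h _; rewrite [X in _ && X](_ : _ = false) ?andbF ?mulr0//.
  apply: contraTF ks => /subset_leq_card; rewrite -leqNgt => /leq_trans; apply.
  by rewrite (leq_trans (leq_imset_card _ _))// card_ord.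
rewrite c_coef_subsets//.
under eq_bigr do rewrite faces_euler_pow mulr_sumr.
rewrite exchange_big/=; apply: eq_bigr => h _.
under eq_bigr do rewrite mulrCA.
rewrite -mulr_sumr; congr (_ * _).
set Z := _ @: _.
case: (boolP (Z \subset s)) => [/fintype.subsetP Zs|/subsetPn[I IZ Is]]; last first.
  rewrite big1// => U /fintype.subsetP Utop; rewrite (_ : _ \subset _ = false) ?mulr0//.
  apply/subsetPn; exists I => //; rewrite !inE (negbTE Is) andbF orbF.
  by apply: contra Is => /Utop; exact/fintype.subsetP/top_faces_sub.
rewrite -(sum_missing_subsets (top_faces s) Z) big_mkcondr/=; apply: eq_bigr => U Utop.
suff -> : Z \subset U :|: low_faces s = (top_faces s :&: Z \subset U).
  by case: ifP; rewrite ?mulr1 ?mulr0.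
apply/fintype.subsetP/fintype.subsetP => H I.
  rewrite !inE => /andP[It /H]; rewrite !inE => /orP[//|].
  by move: It => /[swap]/andP[/negP].
move=> IZ; rewrite !inE Zs// andbT; case: (boolP (I \in top_faces s)) => It.
  by rewrite H// inE It.
by move: It; rewrite inE => ->; rewrite orbT.
Qed.

Definition face_closure (Z : {set {set 'I_n}}) : {set {set 'I_n}} :=
  [set J | (J != finset.set0) && [exists I in Z, J \subset I]]%SET.

Lemma is_complexP s : reflect
  (finset.set0 \notin s /\ forall I J, I \in s -> J != finset.set0 -> J \subset I -> J \in s)
  (is_complex s).
Proof.
apply: (iffP andP) => -[s0 sP]; split=> //.
  move=> I J Is J0 JI; move/forallP/(_ I): sP; rewrite Is/= => /forallP/(_ J).
  by rewrite J0 JI.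
apply/forallP => I; apply/implyP => Is; apply/forallP => J.
by apply/implyP => /andP[J0 JI]; exact: sP JI.
Qed.

Lemma face_closure_complex Z : is_complex (face_closure Z).
Proof.
apply/is_complexP; rewrite inE eqxx; split=> // I J.
rewrite !inE => /andP[_ /exists_inP[K KZ IK]] J0 JI; rewrite J0.
by apply/exists_inP; exists K => //; exact: fintype.subset_trans IK.
Qed.

Lemma top_face_exists s I : I \in s -> exists2 J, J \in top_faces s & I \subset J.
Proof. by move=> /(@maxset_exists _ (mem s))[J]; exists J => //; rewrite inE. Qed.

(** A set of nonempty sets is squeezed between the top faces and all faces of
    exactly one complex, the one it generates. *)
Lemma complex_squeeze Z s : finset.set0 \notin Z ->
  (is_complex s && ((Z \subset s) && (top_faces s \subset Z))) = (s == face_closure Z).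
Proof.
move=> Z0; apply/idP/eqP => [/and3P[/is_complexP[s0 sP] /fintype.subsetP Zs /fintype.subsetP topZ]|->].
  apply/setP => J; rewrite inE; apply/idP/andP => [Js|[J0 /exists_inP[I /Zs Is]]].
    split; first by apply: contraNneq s0 => <-.
    have [I /topZ IZ JI] := top_face_exists Js.
    by apply/exists_inP; exists I.
  exact: sP.
rewrite face_closure_complex/=; apply/andP; split; apply/fintype.subsetP => I.
  move=> IZ; rewrite inE; apply/andP; split; first by apply: contraNneq Z0 => <-.
  by apply/exists_inP; exists I.
rewrite inE => /maxsetP[]; rewrite unfold_in/= inE.
move=> /andP[I0 /exists_inP[J JZ IJ]] /(_ J) H.
have E : J = I.
  apply: H => //; rewrite inE; apply/andP; split; first by apply: contraNneq Z0 => <-.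
  by apply/exists_inP; exists J.
by move: JZ; rewrite E.
Qed.

(** The words in the faces of a complex are sorted by the subcomplex that they
    generate, so that the coefficients of the subcomplexes add up to the power
    of the Euler characteristic. *)
Lemma sum_c_coef s k : is_complex s ->
  \sum_(t : {set {set 'I_n}} | is_complex t && (t \subset s)) c_coef t k =
  faces_euler s ^+ k.
Proof.
move=> /is_complexP[s0 sP]; rewrite faces_euler_pow.
under eq_bigr => t /andP[/is_complexP[t0 _] _] do rewrite c_coef_words//.
rewrite exchange_big/=; apply: eq_bigr => h _; rewrite -mulr_sumr; congr (_ * _).
set Z := _ @: _.
rewrite (eq_bigr (fun t : {set {set 'I_n}} => if (Z \subset t) && (top_faces t \subset Z) then 1 else 0 : int));
  last by move=> t _; case: ifP.
rewrite -big_mkcondr/=.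
under eq_bigl do rewrite andbAC.
case: (boolP (Z \subset s)) => [/fintype.subsetP Zs|Zs]; last first.
  rewrite big_pred0// => t; apply/negP => /andP[/and3P[_ Zt _] ts].
  by move/negP : Zs; apply; exact: fintype.subset_trans ts.
under eq_bigl do rewrite complex_squeeze ?(contra (Zs _))//.
rewrite (bigD1 (face_closure Z))/= ?big_pred0 ?addr0//.
  by move=> t; case: eqP; rewrite /= ?andbF.
rewrite eqxx/=; apply/fintype.subsetP => J; rewrite inE => /andP[J0 /exists_inP[I /Zs Is]].
exact: sP.
Qed.

End coefficient_identity.

(** * Lagrange interpolation *)

Section lagrange.
Variables (R : realType) (lo hi : int).

Lemma v_coef_horner (x : int) :
  \sum_(0 <= k < (range_len lo hi).+1) v_coef lo hi k * x%:~R ^+ k =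
  ((range_len lo hi)`!)%:R^-1 *
  \prod_(l < range_len lo hi) (lo + (l : nat)%:Z + 1 - x)%:~R :> R.
Proof.
set m := range_len lo hi.
pose a (l : 'I_m) : R := (lo + (l : nat)%:Z + 1)%:~R.
under [in RHS]eq_bigr => l _ do rewrite rmorphB/= -/(a l).
rewrite (@bigA_distr R 0 1 *%R +%R)/=.
rewrite (partition_big (fun J : {set 'I_m} => inord (m - #|J|) : 'I_m.+1) predT)//=.
rewrite big_mkord mulr_sumr; apply: eq_bigr => k _.
rewrite /v_coef -/m [_ / _]mulrC -!mulrA; congr (_ * _).
rewrite mulrCA -exprMn_comm; last exact: commr_int.
rewrite mulN1r mulr_suml; apply: eq_big => J.
  rewrite -val_eqE/= inordK ?ltnS ?leq_subr//.
  have Jm : (#|J| <= m)%N by rewrite -[X in (_ <= X)%N](card_ord m) max_card.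
  move: (ltn_ord k) Jm; rewrite ltnS.
  move: #|J| (k : nat) => x1 x2 k1 k2.
  by apply/eqP/eqP => [->|<-]; rewrite subKn.
move=> /eqP Jk; rewrite [in RHS](bigID (mem J))/=; congr (_ * _).
  by apply: eq_bigr => l ->.
rewrite (eq_bigr (fun=> - x%:~R)); last by move=> l /negbTE ->.
rewrite prodr_const; congr (_ ^+ _).
have := cardsC J; rewrite card_ord Jk => E.
have -> : #|[pred i | i \notin J]| = #|~: J|%SET.
  by apply: eq_card => i; rewrite !inE.
by have := ltn_ord k; lia.
Qed.

(** The product is the Lagrange polynomial of the lower end of the range. *)
Lemma v_coef_indicator (x : int) : lo <= x <= hi ->
  \sum_(0 <= k < (range_len lo hi).+1) v_coef lo hi k * x%:~R ^+ k =
  (x == lo)%:R :> R.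
Proof.
move=> /andP[lox xhi]; rewrite v_coef_horner.
have [->|xlo] := eqVneq x lo.
  rewrite (eq_bigr (fun l : 'I_(range_len lo hi) => (l.+1)%:R)); last first.
    by move=> l _; rewrite pmulrn; congr (_ *~ _); lia.
  suff -> m : \prod_(i < m) i.+1%:R = m`!%:R :> R.
    by rewrite mulVf// pnatr_eq0 -lt0n fact_gt0.
  elim: m => [|m IH]; first by rewrite big_ord0.
  by rewrite big_ord_recr/= IH factS mulnC natrM.
have lm : (absz (x - lo - 1)%R < range_len lo hi)%N by rewrite /range_len; lia.
rewrite (bigD1 (Ordinal lm))//= (_ : _ - x = 0) ?mul0r ?mulr0//.
by lia.
Qed.

End lagrange.

(** * Ranks of incidence matrices *)

Section incidence.
Variables (X C : eqType) (Vs : seq X) (Es : seq C) (s t : C -> X).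
Hypotheses (Vs_uniq : uniq Vs) (Es_uniq : uniq Es).
Hypothesis st_in : forall c, c \in Es -> s c \in Vs /\ t c \in Vs.

Let v := tnth (in_tuple Vs).
Let c := tnth (in_tuple Es).
Let M : 'M[rat]_(size Vs, size Es) :=
  \matrix_(i, j) ((v i == t (c j))%:R - (v i == s (c j))%:R).
Let rowf (f : X -> rat) : 'rV[rat]_(size Vs) := \row_i f (v i).

Let v_inj : injective v.
Proof. by apply/tuple_uniqP. Qed.

Let c_inj : injective c.
Proof. by apply/tuple_uniqP. Qed.

Let c_in j : c j \in Es. Proof. exact: mem_tnth. Qed.

Let sum_at (f : X -> rat) y : y \in Vs ->
  \sum_(i < size Vs) f (v i) * (v i == y)%:R = f y.
Proof.
move=> yVs; rewrite -(big_tnth _ _ _ xpredT (fun x => f x * (x == y)%:R)).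
rewrite (bigD1_seq y)//= eqxx mulr1 big1 ?addr0// => x /negbTE ->.
by rewrite mulr0.
Qed.

Let coboundary f j : (rowf f *m M) ord0 j = f (t (c j)) - f (s (c j)).
Proof.
have [sV tV] := st_in (c_in j).
rewrite mxE -(sum_at f tV) -(sum_at f sV) -sumrB; apply: eq_bigr => i _.
by rewrite !mxE mulrBr.
Qed.

(** The hypothesis says that the coboundary, from functions on the vertices to
    functions on the edges, is onto; its kernel contains the constants. Graph
    theoretically, every component is a tree. *)
Lemma card_edges_lt_vertices :
  (forall c, c \in Es -> exists f : X -> int,
     forall c', c' \in Es -> f (t c') - f (s c') = (c' == c)%:R) ->
  Vs != [::] -> (size Es < size Vs)%N.
Proof.
move=> pot Vs0.
have full : row_full M.
  rewrite -sub1mx; apply/row_subP => j; rewrite rowE mulmx1.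
  have [f fE] := pot _ (c_in j).
  apply/submxP; exists (rowf (fun x => (f x)%:~R)); apply/rowP => k.
  rewrite coboundary -rmorphB/= fE// mxE eqxx/= rmorph_nat.
  by rewrite (inj_eq c_inj).
have kerE : \rank (kermx M) = (size Vs - size Es)%N.
  by rewrite mxrank_ker (eqP full).
rewrite ltnNge; apply/negP => VE; move: kerE; rewrite (eqP (_ : size Vs - size Es == 0)%N) ?subn_eq0//.
move=> /eqP; rewrite mxrank_eq0 => /eqP ker0.
have : (rowf (fun=> 1) <= kermx M)%MS.
  by apply/sub_kermxP/rowP => j; rewrite coboundary subrr mxE.
rewrite ker0 submx0 => /eqP/rowP.
case: Vs Vs0 @v @M @rowf => // x l _ v' M' rowf' /(_ ord0); rewrite !mxE.
by move/eqP; rewrite oner_eq0.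
Qed.

(** Here the kernel of the coboundary consists of the constants only, as for a
    connected graph. *)
Lemma card_vertices_le_edges :
  (forall f : X -> rat, (forall c, c \in Es -> f (t c) = f (s c)) ->
     {in Vs &, forall x y, f x = f y}) ->
  (size Vs <= (size Es).+1)%N.
Proof.
move=> conn.
have : (kermx M <= rowf (fun=> 1))%MS.
  apply/row_subP => k; set u := row k _.
  have uM : u *m M = 0 by apply/sub_kermxP; rewrite row_sub.
  pose f x := \sum_(i < size Vs) u ord0 i * (v i == x)%:R.
  have fv i : f (v i) = u ord0 i.
    rewrite /f (bigD1 i)//= eqxx mulr1 big1 ?addr0// => j ji.
    by rewrite (inj_eq v_inj) (negbTE ji) mulr0.
  have uE : u = rowf f by apply/rowP => i; rewrite [RHS]mxE fv.
  have fconst : {in Vs &, forall x y, f x = f y}.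
    apply: conn => c' /(tnthP (in_tuple Es))[j ->]; apply/eqP.
    by rewrite -subr_eq0 -(coboundary f j) -uE uM mxE.
  case: (posnP (size Vs)) => [V0|V0].
    by rewrite uE (_ : rowf f = 0) ?sub0mx//; apply/rowP => i; have := ltn_ord i; rewrite {2}V0.
  rewrite uE (_ : rowf f = f (v (Ordinal V0)) *: rowf (fun=> 1)); first exact: scalemx_sub.
  by apply/rowP => i; rewrite !mxE mulr1; apply: fconst; exact: mem_tnth.
move=> /mxrankS; rewrite mxrank_ker leq_subLR => /leq_trans; apply.
rewrite -[X in (_ <= X)%N]addn1 leq_add ?rank_leq_col//; exact: rank_leq_row.
Qed.

End incidence.

(** * Cuts of acyclic sets of edges *)

Section acyclic_edges.
Variables (R : realType) (G : multigraph R) (S : {set edge G}) (e : edge G).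

Let adj : rel (vertex G) := fun u v =>
  [exists d : edge G * bool,
    [&& d.1 \in S, d.1 != e, osrc d == u & otgt d == v]].

(** A path of distinct vertices, lifted to oriented edges, does not repeat an
    edge: the edge that leaves u would have u as an end later on the path. *)
Lemma adj_path u p d : path.path adj u p -> uniq (u :: p) -> otgt d = u ->
  exists c : seq (edge G * bool),
  [/\ path.path (fun d d' => otgt d == osrc d') d c, otgt (last d c) = last u p,
      [seq osrc d' | d' <- c] = belast u p, uniq [seq d'.1 | d' <- c] &
      forall d', d' \in c ->
        [&& d'.1 \in S, d'.1 != e, src d'.1 \in u :: p & tgt d'.1 \in u :: p]].
Proof.
elim: p u d => [|v p IH] u d /=; first by exists nil.
move=> /andP[/existsP[d1 /and4P[d1S d1e /eqP d1u /eqP d1v]] vp] /andP[uvp vp_uniq] du.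
have [c [c_path c_last c_src c_uniq cS]] := IH v d1 vp vp_uniq d1v.
exists (d1 :: c); split => /=.
- by rewrite du d1u eqxx.
- by [].
- by rewrite d1u c_src.
- rewrite c_uniq andbT; apply: contra uvp => /mapP[d2 /cS /and4P[_ _ s2 t2] E].
  by rewrite -d1u /osrc E; case: ifP.
- move=> d2; rewrite !inE => /orP[/eqP ->|/cS /and4P[-> -> s2 t2]]; last first.
    by move: s2 t2; rewrite !inE => -> ->; rewrite !orbT.
  rewrite d1S d1e/= -d1u -d1v /osrc /otgt.
  by case: ifP => _; rewrite !eqxx ?orbT.
Qed.

(** If no cycle uses only edges of the set, an edge of the set joins two
    components of the graph of the other edges; one of them is the cut. *)
Lemma acyclic_cut : e \in S ->
  (forall c : seq (edge G * bool), is_cycle c -> exists2 d, d \in c & d.1 \notin S) ->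
  exists F : vertex G -> bool, [/\ F (tgt e) = true, F (src e) = false &
    forall e', e' \in S -> e' != e -> F (src e') = F (tgt e')].
Proof.
move=> eS acyclic; exists (connect adj (tgt e)); split; first exact: connect0.
  apply/negP => /connectP[p0 p0_path]; case: (shortenP p0_path) => p p_path p_uniq _ p_last.
  have [c [c_path c_last c_src c_uniq cS]] := adj_path p_path p_uniq (erefl : otgt (e, false) = tgt e).
  have : is_cycle ((e, false) :: c).
    apply/and4P; split => //=.
    - by rewrite rcons_path c_path/= c_last -p_last.
    - by rewrite c_uniq andbT; apply/mapP => -[d /cS /and4P[_ /eqP de _ _] /esym].
    - by rewrite c_src [osrc (e, false)]/osrc/= p_last -rcons_uniq -lastI.
  move=> /acyclic[d]; rewrite inE => /orP[/eqP->|/cS /and4P[-> //]].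
  by rewrite eS.
move=> e' e'S e'e; apply/idP/idP => /connect_trans; apply; apply: connect1;
  apply/existsP; [exists (e', false)|exists (e', true)];
  by rewrite e'S e'e /osrc /otgt/= !eqxx.
Qed.

End acyclic_edges.

(** * Points, paths and segments *)

Section points.
Variables (R : realType) (G : multigraph R).
Local Notation X := (realization G).
Implicit Types (x y : X) (e : edge G) (t u : R).

Definition vpt (v : vertex G) : X := exist _ (inl v) isT.

Definition raw_point e t : vertex G + edge G * R :=
  if t <= 0 then inl (src e) else if len e <= t then inl (tgt e) else inr (e, t).

Lemma raw_point_is_point e t : is_point (raw_point e t).
Proof.
rewrite /raw_point; case: leP => // t0; case: leP => //= te.
by rewrite t0 te.
Qed.

(** The point at distance t from the source of e along e. Parameters outside
    the edge are sent to its ends, which makes this map continuous on R. *)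
Definition pt e t : X := exist _ (raw_point e t) (raw_point_is_point e t).

Lemma val_inj_point x y : val x = val y -> x = y.
Proof.
case: x y => [x xP] [y yP] /= E; case: _ / E yP => yP.
by congr exist; exact: eq_irrelevance.
Qed.

Lemma pt0 e : pt e 0 = vpt (src e).
Proof. by apply: val_inj_point; rewrite /= /raw_point lexx. Qed.

Lemma pt_len e : pt e (len e) = vpt (tgt e).
Proof. by apply: val_inj_point; rewrite /= /raw_point leNgt len_gt0/= lexx. Qed.

Lemma val_pt e t : 0 < t < len e -> val (pt e t) = inr (e, t).
Proof. by move=> /andP[t0 te]; rewrite /= /raw_point leNgt t0/= leNgt te. Qed.

Lemma has_coordP e t x : has_coord e t x <-> 0 <= t <= len e /\ x = pt e t.
Proof.
split; last first.
  move=> [/andP[t0 te] ->]; rewrite /has_coord/= /raw_point.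
  case: leP => [t0'|t0']; first by left; split=> //; apply/eqP; rewrite eq_le t0 t0'.
  by case: leP => [te'|//]; right; split=> //; apply/eqP; rewrite eq_le te te'.
have e0 := len_gt0 e.
case: x => [[v|[e' t']] xP]; rewrite /has_coord/=.
  by case=> -[-> ->]; rewrite lexx ?ltW//; split=> //; apply: val_inj_point;
    rewrite ?pt0 ?pt_len.
move: xP => /[swap] -[<- <-] xP; have /andP[t0 te] := xP.
by rewrite !ltW//; split => //; apply: val_inj_point; rewrite val_pt.
Qed.

Lemma has_coord_pt e t : 0 <= t <= len e -> has_coord e t (pt e t).
Proof. by move=> te; apply/has_coordP. Qed.

Lemma point_cases x :
  (exists v, x = vpt v) \/ (exists e t, 0 < t < len e /\ x = pt e t).
Proof.
case: x => [[v|[e t]] xP]; first by left; exists v; exact: val_inj_point.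
by right; exists e, t; split=> //; apply: val_inj_point; rewrite val_pt.
Qed.

Lemma pt_inj e t e' t' : 0 < t < len e -> 0 <= t' <= len e' ->
  pt e t = pt e' t' -> e = e' /\ t = t'.
Proof.
move=> te te' E; have [_] : has_coord e' t' (pt e t) <-> _ := has_coordP _ _ _.
by move=> /(_ (conj te' E)); rewrite /has_coord val_pt// => -[-> ->].
Qed.

Lemma vpt_neq_pt v e t : 0 < t < len e -> vpt v <> pt e t.
Proof. by move=> te /(congr1 val); rewrite val_pt. Qed.

(** A path is encoded by the list of its segments: (e, t, u) leads along e
    from coordinate t to coordinate u. *)
Definition segment : Type := edge G * R * R.

Fixpoint seg_path (x : X) (s : seq segment) (y : X) : Prop :=
  if s is (e, t, u) :: s' then
    [/\ 0 <= t <= len e, 0 <= u <= len e, x = pt e t & seg_path (pt e u) s' y]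
  else x = y.

Definition seg_len (s : seq segment) : R := \sum_(c <- s) `|c.1.2 - c.2|.

Lemma seg_len_cons c s : seg_len (c :: s) = `|c.1.2 - c.2| + seg_len s.
Proof. by rewrite /seg_len big_cons. Qed.

Lemma seg_len_ge0 s : 0 <= seg_len s.
Proof. exact: sumr_ge0. Qed.

Lemma is_pathP x y l : is_path x y l <-> exists2 s, seg_path x s y & l = seg_len s.
Proof.
split=> [|[s]].
  elim=> [{}x|{}x y' z e t u {}l /has_coordP[te ->] /has_coordP[ue ->] _ [s sP ->]].
    by exists [::] => //; rewrite /seg_len big_nil.
  by exists ((e, t, u) :: s) => //; rewrite seg_len_cons.
elim: s x l => [|[[e t] u] s IH] x l /=.
  by move=> -> ->; rewrite /seg_len big_nil; exact: path_nil.
move=> [te ue -> sP] ->; rewrite seg_len_cons/=.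
by apply: path_cons (has_coord_pt te) (has_coord_pt ue) _; exact: IH.
Qed.

Lemma seg_path_cat x y z s1 s2 :
  seg_path x s1 y -> seg_path y s2 z -> seg_path x (s1 ++ s2) z.
Proof.
elim: s1 x => [|[[e t] u] s1 IH] x /=; first by move=> ->.
by move=> [te ue -> /IH] + /[dup] => /[apply].
Qed.

Definition seg_rev (s : seq segment) : seq segment :=
  rev [seq (c.1.1, c.2, c.1.2) | c <- s].

Lemma seg_path_rev x y s : seg_path x s y -> seg_path y (seg_rev s) x.
Proof.
rewrite /seg_rev; elim: s x => [|[[e t] u] s IH] x /=; first by move=> ->.
move=> [te ue -> /IH yu]; rewrite rev_cons -cats1.
by apply: seg_path_cat yu _; split.
Qed.

Lemma seg_len_rev s : seg_len (seg_rev s) = seg_len s.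
Proof.
rewrite /seg_len (perm_big [seq (c.1.1, c.2, c.1.2) | c <- s]) ?perm_rev//=.
by rewrite big_map; apply: eq_bigr => c _ /=; rewrite distrC.
Qed.

Lemma seg_len_cat s1 s2 : seg_len (s1 ++ s2) = seg_len s1 + seg_len s2.
Proof. by rewrite /seg_len big_cat. Qed.

Lemma ballP x r y : ball x r y <-> exists2 s, seg_path x s y & seg_len s < r.
Proof.
split; first by case=> l /is_pathP[s sP ->] lr; exists s.
by case=> s sP sr; exists (seg_len s) => //; apply/is_pathP; exists s.
Qed.

Lemma ball_pt e t u r : `|t - u| < r -> ball (pt e t) r (pt e u).
Proof.
move=> tur; pose c a := Num.max 0 (Num.min a (len e)).
have e0 := len_gt0 e.
have cI a : 0 <= c a <= len e by rewrite /c le_max lexx/= ge_max ge_min lexx orbT ltW.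
have cE a : pt e a = pt e (c a).
  apply: val_inj_point; rewrite /= /raw_point /c.
  have [a0|a0] := leP a 0; first by rewrite min_l ?max_l ?lexx// (le_trans a0)// ltW.
  have [ea|ea] := leP (len e) a; last first.
    by rewrite (max_r (ltW a0)) (leNgt a 0) a0/= (leNgt (len e)) ea.
  by rewrite (max_r (ltW e0)) leNgt e0/= lexx.
apply/ballP; exists [:: (e, c t, c u)].
  by split=> //; rewrite -?cE.
rewrite seg_len_cons /seg_len big_nil addr0/=; apply: le_lt_trans tur.
rewrite /c; case: (leP t (len e)) => ?; case: (leP u (len e)) => ?;
  rewrite ?(max_r (ltW e0)); case: (leP 0 t) => ?; case: (leP 0 u) => ?;
  rewrite ?(max_l (ltW _)) ?max_r//; rewrite !ler_norml; have := ler_norm (t - u);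
  have := ler_norm (u - t); rewrite distrC; lra.
Qed.

Lemma continuous_pt e : continuous (pt e).
Proof.
move=> t; apply/cvg_ballP => r r0.
by apply/nbhs_ballP; exists r => //= u tu; exact: ball_pt.
Qed.

(** Such a path is too short to reach an end of the edge. *)
Lemma seg_path_interior e t s y : 0 < t < len e -> seg_path (pt e t) s y ->
  seg_len s < t -> seg_len s < len e - t ->
  exists u, [/\ 0 < u < len e, `|t - u| <= seg_len s & y = pt e u].
Proof.
elim: s t => [|[[e' t'] u'] s IH] t te /=.
  by move=> <- _ _; exists t; rewrite subrr normr0 seg_len_ge0.
move=> [te' ue' E sP]; have [? ?] := pt_inj te te' E; subst e' t'.
rewrite seg_len_cons/= => l1 l2; have s0 := seg_len_ge0 s.
have tu : `|t - u'| < t /\ `|t - u'| < len e - t by split; lra.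
have ue : 0 < u' < len e by move: tu; rewrite !ltr_norml; lra.
have [||u [ueP uP ->]] := IH u' ue sP.
- by move: l1 l2; have := ler_norm (t - u'); lra.
- by move: l1 l2; have := ler_norm (u' - t); rewrite distrC; lra.
exists u; split=> //; rewrite -(subrKA u'); apply: le_trans (ler_normD _ _) _.
by rewrite lerD2l.
Qed.

Definition near_vertex v l x := x = vpt v \/
  exists e t, [/\ 0 <= t <= len e, x = pt e t &
    (src e = v /\ t <= l) \/ (tgt e = v /\ len e - t <= l)].

Lemma pt_vpt e t v : 0 <= t <= len e -> pt e t = vpt v ->
  (t = 0 /\ src e = v) \/ (t = len e /\ tgt e = v).
Proof.
have [->|t0] := eqVneq t 0; first by move=> _; rewrite pt0 => /(congr1 val)[->]; left.
have [->|tl] := eqVneq t (len e).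
  by move=> _; rewrite pt_len => /(congr1 val)[->]; right.
move=> /andP[t0' tl'] /esym/vpt_neq_pt H; exfalso; apply: H.
by rewrite !lt_neqAle t0' tl' tl eq_sym t0.
Qed.

Lemma near_vertex_vpt m v l w : (forall e, m <= len e) -> l < m ->
  near_vertex v l (vpt w) -> w = v.
Proof.
move=> mlen lm [/(congr1 val)[]//|[e [t [te /esym/(pt_vpt te) + H]]]].
have := mlen e; have := len_gt0 e.
move=> e0 me; case: H => -[<- H] [] [E <-] //; exfalso; rewrite E in H.
  by have := le_lt_trans H lm; rewrite ltNge me.
by move: H; rewrite subr0 => H; have := le_lt_trans H lm; rewrite ltNge me.
Qed.

(** A path shorter than all edges cannot pass through another vertex on its way
    to v. *)
Lemma seg_path_to_vertex m x s v : (forall e, m <= len e) ->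
  seg_path x s (vpt v) -> seg_len s < m -> near_vertex v (seg_len s) x.
Proof.
move=> mlen; elim: s x => [|[[e t] u] s IH] x /=; first by left.
move=> [te ue -> sP]; rewrite seg_len_cons/= => sm.
have s0 := seg_len_ge0 s; have tu0 := normr_ge0 (t - u).
have sm' : seg_len s < m by lra.
have near := IH _ sP sm'; right; exists e, t; split => //.
have t1 := ler_norm (t - u); have t2 := ler_norm (u - t); rewrite distrC in t2.
have := ue; rewrite le_eqVlt => /andP[/predU1P[u0|u0]].
  rewrite -u0 pt0 in near; move=> _; left; split; last by rewrite -u0 in t1 *; lra.
  exact: near_vertex_vpt near.
rewrite le_eqVlt => /predU1P[ul|ul].
  rewrite ul pt_len in near; right; split; last by rewrite ul in t2 *; lra.
  exact: near_vertex_vpt near.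
have uei : 0 < u < len e by rewrite u0.
case: near => [/esym/vpt_neq_pt|[e' [u' [ue' /(pt_inj uei ue')[? ?]]]]]; first by move=> /(_ uei).
by subst e' u' => -[[<- ?]|[<- ?]]; [left|right]; split=> //; lra.
Qed.

Lemma min_len : exists2 m : R, 0 < m & forall e, m <= len e.
Proof.
exists (\big[Num.min/1]_(e : edge G) len e); first last.
  by move=> e; exact: bigmin_le_cond.
by elim/big_ind: _ => // [x y x0 y0|e _]; [rewrite lt_min x0|exact: len_gt0].
Qed.

Lemma points_separated x y : x <> y ->
  exists2 r : R, 0 < r & forall s, seg_path x s y -> r <= seg_len s.
Proof.
have int_sep e t z : 0 < t < len e -> pt e t <> z ->
    exists2 r : R, 0 < r & forall s, seg_path (pt e t) s z -> r <= seg_len s.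
  move=> te tz; have /andP[t0 tl] := te.
  have [[u [ue zE]]|zN] := pselect (exists u, 0 < u < len e /\ z = pt e u).
    have tu : t - u != 0 by rewrite subr_eq0; apply: contra_notN tz => /eqP ->.
    exists (Num.min (Num.min t (len e - t)) `|t - u|).
      by rewrite !lt_min t0 subr_gt0 tl normr_gt0 tu.
    move=> s sP; rewrite leNgt; apply/negP; rewrite !lt_min => /andP[/andP[s1 s2] s3].
    have [u' [u'e tu' zE']] := seg_path_interior te sP s1 s2.
    have [_ E] : e = e /\ u' = u.
      by apply: pt_inj; rewrite // -?zE' ?zE//; move: ue => /andP[? ?]; rewrite !ltW.
    by move: s3; rewrite -E ltNge tu'.
  exists (Num.min t (len e - t)); first by rewrite lt_min t0 subr_gt0.
  move=> s sP; rewrite leNgt; apply/negP; rewrite lt_min => /andP[s1 s2].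
  by have [u' [u'e tu' zE']] := seg_path_interior te sP s1 s2; apply: zN; exists u'.
move=> xy; case: (point_cases x) => [[v xE]|[e [t [te xE]]]]; last first.
  by rewrite xE; apply: int_sep => //; rewrite -xE.
case: (point_cases y) => [[w yE]|[e [t [te yE]]]]; last first.
  have [r r0 H] := int_sep e t x te (fun E => xy (esym (etrans yE E))).
  by exists r => // s; rewrite yE => /seg_path_rev/H; rewrite seg_len_rev.
have [m m0 mlen] := min_len; exists m => // s sP; rewrite leNgt; apply/negP => sm.
rewrite yE in sP; have := seg_path_to_vertex mlen sP sm; rewrite xE => /(near_vertex_vpt mlen sm) E.
by apply: xy; rewrite xE yE E.
Qed.

Lemma realization_hausdorff : hausdorff_space X.
Proof.
rewrite ball_hausdorff => x y /eqP/points_separated[r r0 rP].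
have r20 : 0 < r / 2 by rewrite divr_gt0.
exists (PosNum r20, PosNum r20) => /=; apply/eqP/seteqP; split => // z [xz /ball_sym zy].
have [s sP sr] := (ballP x r y).1 (ball_split xz zy).
by have := rP s sP; rewrite leNgt sr.
Qed.

Lemma realization_compact : compact [set: X].
Proof.
have -> : [set: X] = \big[setU/set0]_(v : vertex G) [set vpt v] `|`
    \big[setU/set0]_(e : edge G) (pt e @` `[0, len e]).
  rewrite -!bigcup_seq.
  apply/seteqP; split=> // x _; case: (point_cases x) => [[v ->]|[e [t [/andP[t0 te] ->]]]].
    by left; exists v => //=; rewrite mem_index_enum.
  by right; exists e => /=; [rewrite mem_index_enum|exists t => //=; rewrite in_itv/= !ltW].
apply: compactU.
  apply: bigsetU_compact => v _; exact: compact_set1.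
apply: bigsetU_compact => e _; apply: continuous_compact; last exact: segment_compact.
by apply: continuous_subspaceT; exact: continuous_pt.
Qed.

Lemma closed_seg e p q : closed (pt e @` `[p, q]).
Proof.
apply: compact_closed; first exact: realization_hausdorff.
apply: continuous_compact; last exact: segment_compact.
by apply: continuous_subspaceT; exact: continuous_pt.
Qed.


(** * Crossings of short closed paths *)

(** Half-open intervals allow an induction that removes an interval containing
    the right end b: it leaves an interval of the same kind, ending at the left
    end of the removed one. *)
Lemma interval_cover (s : seq (R * R)) a b : a <= b ->
  (forall z, a < z <= b -> exists2 c, c \in s & (z <= c.1) != (z <= c.2)) ->
  b - a <= \sum_(c <- s) `|c.1 - c.2|.
Proof.
have [n] := ubnP (size s); elim: n s b => // n IH s b sn ab cov.
move: (ab); rewrite le_eqVlt => /predU1P[->|ab'].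
  by rewrite subrr; apply: sumr_ge0.
have [|[c1 c2] cs bc] := cov b; first by rewrite ab' lexx.
rewrite (big_rem _ cs)/=.
have s0 : 0 <= \sum_(c <- rem (c1, c2) s) `|c.1 - c.2| by apply: sumr_ge0.
have cN : `|c1 - c2| = Num.max c1 c2 - Num.min c1 c2.
  case: (leP c1 c2) => c12; first by rewrite ler0_norm ?subr_le0// opprB.
    by rewrite gtr0_norm ?subr_gt0.
have [lob bhi] : Num.min c1 c2 < b /\ b <= Num.max c1 c2.
  by move: bc => /=; case: (leP b c1) => ?; case: (leP b c2) => ? //= _;
    case: (leP c1 c2) => ?; split=> //; lra.
have [loa|alo] := leP (Num.min c1 c2) a; first by rewrite cN; lra.
suff : Num.min c1 c2 - a <= \sum_(c <- rem (c1, c2) s) `|c.1 - c.2| by rewrite cN; lra.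
apply: IH => [||z /andP[az zlo]].
- by rewrite size_rem// -ltnS prednK//; case: (s) cs.
- exact: ltW.
have [|c c_s zc] := cov z; first by rewrite az (le_trans zlo)// ltW.
exists c => //; move: c_s; rewrite (perm_mem (perm_to_rem cs)) inE => /predU1P[E|//].
by move: zlo; rewrite E le_min/= in zc * => /andP[z1 z2]; rewrite z1 z2 in zc.
Qed.

(** A crossing of the point at coordinate z of e counts 1 along e and -1 against
    e. *)
Definition cross e z (c : segment) : int :=
  if c.1.1 == e then (z <= c.2)%R%:Z - (z <= c.1.2)%R%:Z else 0.

Definition crossings e z (s : seq segment) : int := \sum_(c <- s) cross e z c.

Lemma seg_path_sum (F : X -> int) (w : segment -> int) x s y :
  (forall e t u, (e, t, u) \in s -> 0 <= t <= len e -> 0 <= u <= len e ->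
     F (pt e u) - F (pt e t) = w (e, t, u)) ->
  seg_path x s y -> \sum_(c <- s) w c = F y - F x.
Proof.
elim: s x => [|[[e t] u] s IH] x H /=; first by move=> ->; rewrite big_nil subrr.
move=> [te ue -> sP]; rewrite big_cons (IH (pt e u))//; last first.
  by move=> e' t' u' s'; apply: H; rewrite inE s' orbT.
by rewrite -H ?mem_head// addrC subrKA.
Qed.

(** The step function that jumps at one cut point in each edge. *)
Definition extend_cut (F : vertex G -> int) (zeta : edge G -> R) (x : X) : int :=
  match val x with
  | inl v => F v
  | inr (e, t) => if zeta e <= t then F (tgt e) else F (src e)
  end.

Lemma extend_cut_pt F zeta e t : 0 < zeta e <= len e -> 0 <= t <= len e ->
  extend_cut F zeta (pt e t) = if zeta e <= t then F (tgt e) else F (src e).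
Proof.
move=> /andP[z0 zl] /andP[t0 tl]; rewrite /extend_cut.
have [->|tn0] := eqVneq t 0; first by rewrite pt0 /= leNgt z0.
have [->|tnl] := eqVneq t (len e); first by rewrite pt_len /= zl.
by rewrite val_pt// !lt_neqAle t0 tl tnl eq_sym tn0.
Qed.

Let fully_crossed (s : seq segment) : {set edge G} := [set e |
  `[< forall z, 0 < z <= len e -> exists2 c, c \in s & cross e z c != 0 >]]%SET.

Let sum_len_fully_crossed s :
  \sum_(e in fully_crossed s) len e <= seg_len s.
Proof.
have -> : seg_len s = \sum_e \sum_(c <- s | c.1.1 == e) `|c.1.2 - c.2|.
  rewrite (exchange_big_dep xpredT)//=; apply: eq_bigr => c _.
  by rewrite (big_pred1 c.1.1)// => e; rewrite eq_sym.
rewrite big_mkcond/=; apply: ler_sum => e _; case: ifPn => [|_]; last exact: sumr_ge0.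
rewrite inE => /asboolP cov.
have := @interval_cover [seq (c.1.2, c.2) | c <- s & c.1.1 == e] 0 (len e) (ltW (len_gt0 e)).
rewrite subr0 big_map big_filter; apply=> z /cov[c cs].
rewrite /cross; case: ifPn => // ce zc.
exists (c.1.2, c.2); first by apply/mapP; exists c; rewrite // mem_filter ce.
by apply: contra_neq zc => /= ->; rewrite subrr.
Qed.

(** A closed path that is shorter than all cycles cannot cover a cycle of
    edges. Each edge that it does not cover can be cut without meeting the path,
    and the edges that it covers form a forest, on which the crossings of e are
    counted by a function of the points. *)
Lemma short_loop_crossings x s e z : seg_path x s x ->
  ((seg_len s)%:E < girth G)%E -> 0 < z <= len e -> crossings e z s = 0.
Proof.
move=> sP sg ze; set S := fully_crossed s.
have acyclic c : is_cycle c -> exists2 d, d \in c & d.1 \notin S.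
  move=> cc; apply: contrapT => H.
  have cS d : d \in c -> d.1 \in S by move=> dc; apply: contraT => dS; case: H; exists d.
  have : (girth G <= (\sum_(d <- c) len d.1)%:E)%E.
    by apply: ereal_inf_lbound; exists c.
  rewrite leNgt => /negP; apply; apply: le_lt_trans sg; rewrite lee_fin.
  apply: le_trans (sum_len_fully_crossed s).
  have /and4P[_ _ c_uniq _] := cc.
  rewrite -(big_map (fun d : edge G * bool => d.1) xpredT (fun e => len e)).
  rewrite (big_uniq _ c_uniq)/= big_mkcond [X in _ <= X]big_mkcond/=.
  apply: ler_sum => i _; case: ifPn => [/mapP[d /cS dS ->]|_]; first by rewrite dS.
  by case: ifP => // _; exact/ltW/len_gt0.
(* The point at zt of an edge outside S is the place where the edge is cut. *)
have zetaP e' : exists zt, 0 < zt <= len e' /\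
    (e' \notin S -> forall c, c \in s -> cross e' zt c = 0).
  have [e'S|] := boolP (e' \in S).
    by exists (len e'); rewrite len_gt0 lexx.
  rewrite inE => /asboolPn/existsNP[zt /not_implyP[zte' nc]].
  exists zt; split=> // _ c cs; apply: contrapT => /eqP c0.
  by apply: nc; exists c.
have [eS|eS] := boolP (e \in S); last first.
  have [zt [zte /(_ eS) ztc]] := zetaP e.
  (* The edge e itself can be cut at zt, and moving the cut from zt to z does not
     change the number of crossings of a closed path. *)
  pose F (y : X) : int := if val y is inr (e', t) then
    (if e' == e then (z <= t)%R%:Z - (zt <= t)%R%:Z else 0) else 0.
  have FE e' t : 0 <= t <= len e' ->
      F (pt e' t) = if e' == e then (z <= t)%R%:Z - (zt <= t)%R%:Z else 0.
    move=> /andP[t0 tl]; rewrite /F; move: ze zte => /andP[z0 zl] /andP[zt0 ztl].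
    have [->|tn0] := eqVneq t 0.
      by rewrite pt0/= !leNgt z0 zt0; case: ifP.
    have [->|tnl] := eqVneq t (len e').
      by rewrite pt_len/=; case: eqP => // ->; rewrite zl ztl.
    by rewrite val_pt// !lt_neqAle t0 tl tnl eq_sym tn0.
  rewrite /crossings (eq_big_seq (fun c => cross e z c - cross e zt c)); last first.
    by move=> c cs; rewrite ztc// subr0.
  rewrite (@seg_path_sum F _ x s x) ?subrr// => e' t u _ te ue.
  rewrite !FE// /cross/=; case: ifP => // _.
  by case: (z <= u); case: (z <= t); case: (zt <= u); case: (zt <= t).
have [F0 [F1 F2 F3]] := acyclic_cut eS acyclic.
pose F v : int := F0 v.
pose zeta e' := if e' == e then z else sval (cid (zetaP e')).
have zeta_in e' : 0 < zeta e' <= len e'.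
  rewrite /zeta; case: eqP => [->//|_]; by case: cid => ? [].
rewrite /crossings (@seg_path_sum (extend_cut F zeta) _ x s x) ?subrr//.
move=> e' t u cs te ue; rewrite !extend_cut_pt//.
have -> : (if zeta e' <= u then F (tgt e') else F (src e')) -
   (if zeta e' <= t then F (tgt e') else F (src e')) =
   (F (tgt e') - F (src e')) * cross e' (zeta e') (e', t, u).
  rewrite /cross/= eqxx; case: ifP => _; case: ifP => _ /=;
      by rewrite ?subrr ?mulr0 ?subr0 ?mulr1 ?sub0r ?mulrN1 ?opprB.
have [E|ne] := eqVneq e' e.
  by rewrite /zeta E eqxx /F F1 F2 subr0 mul1r.
rewrite [RHS]/cross/= (negbTE ne).
have [e'S|e'S] := boolP (e' \in S); first by rewrite /F (F3 e')// subrr mul0r.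
rewrite [cross _ _ _](_ : _ = 0) ?mulr0// /zeta (negbTE ne).
by case: cid => zt /= [_ H]; exact: H e'S _ cs.
Qed.

Lemma crossings_cat e z s1 s2 :
  crossings e z (s1 ++ s2) = crossings e z s1 + crossings e z s2.
Proof. by rewrite /crossings big_cat. Qed.

Lemma crossings_rev e z s : crossings e z (seg_rev s) = - crossings e z s.
Proof.
rewrite /crossings (perm_big [seq (c.1.1, c.2, c.1.2) | c <- s]) ?perm_rev//=.
rewrite big_map -sumrN; apply: eq_bigr => c _; rewrite /cross/=.
by case: ifP => // _; rewrite ?oppr0// opprB.
Qed.

(** The two paths form a short closed path. *)
Lemma short_paths_crossings x y s1 s2 e z : seg_path x s1 y -> seg_path x s2 y ->
  ((seg_len s1 + seg_len s2)%:E < girth G)%E -> 0 < z <= len e ->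
  crossings e z s1 = crossings e z s2.
Proof.
move=> p1 /seg_path_rev p2 lg ze.
have := short_loop_crossings (seg_path_cat p1 p2) _ ze.
rewrite seg_len_cat seg_len_rev => /(_ lg).
by rewrite crossings_cat crossings_rev => /eqP; rewrite subr_eq0 => /eqP.
Qed.

Lemma girth_ge m : 0 <= m -> (forall e, m <= len e) -> (m%:E <= girth G)%E.
Proof.
move=> m0 mlen; apply: le_ereal_inf_tmp => _ [[//|d c] cc <-].
rewrite lee_fin big_cons -[m]addr0 lerD//; apply: sumr_ge0 => *; exact/ltW/len_gt0.
Qed.

End points.

(** * Contractible sets *)

Section uniform_continuity.
Variables (R : realType) (T Y : pseudoMetricType R).

Lemma within_continuous_nbhs (K : set T) (f : T -> Y) x r :
  {within K, continuous f} -> K x -> 0 < r ->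
  exists2 d : R, 0 < d & forall y, K y -> ball x d y -> ball (f x) r (f y).
Proof.
move=> fc Kx r0; have := fc x _ (nbhsx_ballx (f x) r r0).
rewrite -[X in X -> _]/(@nbhs_subspace T K x (f @^-1` ball (f x) r)).
rewrite -(nbhs_subspace_in Kx) => /nbhs_ballP[d d0 dP].
by exists d => // y Ky xy; exact: dP.
Qed.

Lemma compact_unif_continuous (K : set T) (f : T -> Y) r : compact K ->
  {within K, continuous f} -> 0 < r ->
  exists2 d : R, 0 < d & forall x y, K x -> K y -> ball x d y -> ball (f x) r (f y).
Proof.
move=> /compact_near_coveringP cK fc r0.
have r20 : 0 < r / 2 by rewrite divr_gt0.
pose Q (d : R) (x : T) := K x -> forall y, K y -> ball x d y -> ball (f x) r (f y).
suff /filter_ex[d [d0 dP]] : \forall d \near 0^'+, 0 < d /\ K `<=` Q d.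
  by exists d => // x y Kx Ky xy; exact: dP.
suff : \forall d \near 0^'+, K `<=` Q d.
  move=> KQ; near=> d; split; near: d; [exact: nbhs_right_gt|exact: KQ].
apply: (cK R 0^'+ Q) => x Kx.
have [d d0 dP] := within_continuous_nbhs fc Kx r20.
have d20 : 0 < d / 2 by rewrite divr_gt0.
exists (ball x (d / 2), [set d' | d' < d / 2]) => /=.
  by split; [exact: nbhsx_ballx|exact: nbhs_right_lt].
move=> [x' d'] /= [xx' d'd] Kx' y Ky x'y.
apply: (@ball_split _ _ (f x)).
  apply/ball_sym/dP => //; apply: le_ball xx'; lra.
apply: dP => //; apply: (ball_split xx'); apply: le_ball x'y; lra.
Unshelve. all: by end_near. Qed.

End uniform_continuity.

Section contractible_sets.
Variables (R : realType).

(** The contraction joins each point to the same point inside the set. *)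
Lemma contractible_connected (T : pseudoMetricType R) (A : set T) :
  contractible R A -> connected A.
Proof.
move=> [a Aa [H [Hc HA H0 H1]]].
have -> : A = \bigcup_(x in A) ((fun t => H (x, t)) @` `[0, 1]).
  apply/seteqP; split => [x Ax|_ [x Ax [t t01 <-]]]; last first.
    by apply: HA => //; move: t01; rewrite /= in_itv.
  by exists x => //; exists 0; rewrite ?H0//= in_itv/= lexx ler01.
apply: bigcup_connected.
  by exists a => x Ax; exists 1; rewrite ?H1//= in_itv/= lexx ler01.
move=> x Ax; apply: connected_continuous_connected; first exact: segment_connected.
apply/subspace_continuousP => t t01; apply/cvg_ballP => r r0.
have Kxt : (A `*` `[0 : R, 1]) (x, t) by [].
have [d d0 dP] := within_continuous_nbhs Hc Kxt r0.
apply/nbhs_ballP; exists d => // u tu u01; apply: dP => //.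
by split=> //; exact: ballxx.
Qed.

End contractible_sets.

Section potential.
Variables (R : realType) (G : multigraph R).
Local Notation X := (realization G).
Implicit Types (x y : X).

Variables (e : edge G) (z : R).
Hypothesis ze : 0 < z <= len e.

(** The crossings of some path of length less than r; all such paths have the
    same crossings as soon as 2 r is at most the girth. *)
Definition short_crossings r x y : int :=
  crossings e z (xget [::] [set s | seg_path x s y /\ seg_len s < r]).

Lemma short_crossingsE r x y s : ((r + r)%:E <= girth G)%E ->
  seg_path x s y -> seg_len s < r -> short_crossings r x y = crossings e z s.
Proof.
move=> rg sP sr; rewrite /short_crossings; case: xgetP => [s' _ [s'P s'r]|/(_ s)[]//].
apply: (short_paths_crossings s'P sP) => //; apply: lt_le_trans rg.
by rewrite lte_fin ltrD.
Qed.

Lemma short_crossings_refl r x : ((r + r)%:E <= girth G)%E -> 0 < r ->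
  short_crossings r x x = 0.
Proof.
move=> rg r0; rewrite (@short_crossingsE r x x [::])//.
  by rewrite /crossings big_nil.
by rewrite /seg_len big_nil.
Qed.

Lemma short_crossings_trans r x y w : ((r + r + r)%:E <= girth G)%E -> 0 < r ->
  ball x r y -> ball y r w -> ball x r w ->
  short_crossings r x w = short_crossings r x y + short_crossings r y w.
Proof.
move=> rg r0 /ballP[s1 p1 l1] /ballP[s2 p2 l2] /ballP[s3 p3 l3].
have rg' : ((r + r)%:E <= girth G)%E by apply: le_trans rg; rewrite lee_fin; lra.
rewrite (short_crossingsE rg' p1)// (short_crossingsE rg' p2)// (short_crossingsE rg' p3)//.
rewrite -crossings_cat; apply: (short_paths_crossings p3 (seg_path_cat p1 p2)) => //.
by apply: lt_le_trans rg; rewrite lte_fin seg_len_cat; lra.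
Qed.

Lemma cross_add e' t1 t2 t3 :
  cross e z (e', t1, t2) + cross e z (e', t2, t3) = cross e z (e', t1, t3).
Proof. by rewrite /cross/=; case: ifP => // _; rewrite addrC subrKA. Qed.

(** A contraction moves each point x along a path to a fixed point; the
    crossings of that path, counted in short steps, define a function with the
    differences that a covering of the circle would give. *)
Lemma contractible_potential (T : set X) : compact T -> contractible R T ->
  exists f : X -> int, forall e' p q, p <= q -> 0 <= p -> q <= len e' ->
    (forall t, p <= t <= q -> T (pt e' t)) ->
    f (pt e' q) - f (pt e' p) = cross e z (e', p, q).
Proof.
move=> cT [a Ta [H [Hc HT H0 H1]]].
have [m m0 mlen] := min_len G; have mg := girth_ge (ltW m0) mlen.
(* Triangles with sides less than r are shorter than all cycles. *)
pose r := m / 3; have r0 : 0 < r by rewrite divr_gt0.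
have rg3 : ((r + r + r)%:E <= girth G)%E by apply: le_trans mg; rewrite lee_fin /r; lra.
have rg2 : ((r + r)%:E <= girth G)%E by apply: le_trans rg3; rewrite lee_fin; lra.
have cTI : compact (T `*` `[0 : R, 1]) by apply: compact_setX => //; exact: segment_compact.
have [d d0 dP] := compact_unif_continuous cTI Hc r0.
pose N := (Num.truncn d^-1).+1.
have N0 : 0 < N%:R :> R by rewrite ltr0n.
have Nd : N%:R^-1 < d by rewrite invf_plt ?posrE// truncnS_gt.
pose h x k := H (x, k%:R / N%:R).
have hk k : (k <= N)%N -> 0 <= (k%:R / N%:R : R) <= 1.
  by move=> kN; rewrite divr_ge0//= ler_pdivrMr// mul1r ler_nat.
have hball x y j k : T x -> T y -> ball x d y -> (j <= k <= j.+1)%N -> (k <= N)%N ->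
    ball (h x j) r (h y k).
  move=> Tx Ty xy /andP[jk kj] kN; apply: dP; rewrite /= ?in_itv/=.
  - by split=> //; apply: hk; exact: leq_trans kN.
  - by split=> //; exact: hk.
  split => //=; rewrite /ball/= -mulrBl normrM [X in _ * X]ger0_norm ?invr_ge0//.
  have /orP[/eqP->|/eqP ->] : (k == j) || (k == j.+1) by lia.
    by rewrite subrr normr0 mul0r.
  by rewrite -natr1 opprD addrA subrr sub0r normrN normr1 mul1r.
pose w := short_crossings r.
pose g x : int := \sum_(k < N) w (h x k) (h x k.+1).
have gE x y : T x -> T y -> ball x d y -> g x - g y = w x y.
  move=> Tx Ty xy.
  suff partial j : (j <= N)%N -> \sum_(k < j) w (h x k) (h x k.+1) -
      \sum_(k < j) w (h y k) (h y k.+1) = w x y - w (h x j) (h y j).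
    rewrite /g partial// /h divff ?lt0r_neq0// !H1// /w short_crossings_refl//.
    by rewrite subr0.
  elim: j => [_|j IH jN].
    by rewrite !big_ord0 subrr /h mul0r !H0// subrr.
  rewrite !big_ord_recr/= opprD addrACA IH; last exact: ltnW.
  have xx := ballxx x d0; have yy := ballxx y d0.
  (* The diagonal of the square of these four points has the same crossings as
     each of the two ways around. *)
  have t1 : w (h x j) (h y j.+1) = w (h x j) (h x j.+1) + w (h x j.+1) (h y j.+1).
    by apply: short_crossings_trans => //; apply: hball; rewrite ?leqnn ?leqnSn.
  have t2 : w (h x j) (h y j.+1) = w (h x j) (h y j) + w (h y j) (h y j.+1).
    by apply: short_crossings_trans => //; apply: hball; rewrite ?leqnn ?leqnSn// ltnW.
  rewrite t1 in t2; move: t2.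
  move: (w (h x j) (h x j.+1)) (w (h x j.+1) (h y j.+1)) (w (h x j) (h y j))
    (w (h y j) (h y j.+1)) => w1 w2 w3 w4 E; rewrite -addrA; congr (_ + _).
  by apply/eqP; rewrite -subr_eq0 -[X in _ == X](subrr (w1 + w2)) [X in _ == _ - X]E; apply/eqP; ring.
exists (fun x => - g x) => e' p q pq p0 ql pqT.
(* The segment is cut into M steps that are short enough for gE and for being
   themselves the paths that count the crossings. *)
pose d' := Num.min d r; have d'0 : 0 < d' by rewrite lt_min d0.
pose M := (Num.truncn ((q - p) / d')).+1.
have M0 : 0 < M%:R :> R by rewrite ltr0n.
pose st : R := (q - p) / M%:R.
have st0 : 0 <= st by rewrite divr_ge0 ?subr_ge0.
have std : st < d' by rewrite ltr_pdivrMr// mulrC -ltr_pdivrMr// truncnS_gt.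
have stM : M%:R * st = q - p by rewrite mulrC divfK ?lt0r_neq0.
suff chain i : (i <= M)%N ->
    - g (pt e' (p + i%:R * st)) - - g (pt e' p) = cross e z (e', p, p + i%:R * st).
  by have := chain M (leqnn _); rewrite stM (addrC p) subrK.
elim: i => [_|i IH iM].
  by rewrite mul0r addr0 subrr /cross/= subrr if_same.
have inpq j : (j <= M)%N -> p <= p + j%:R * st <= q.
  move=> jM; rewrite lerDl mulr_ge0//= -lerBrDl -stM ler_wpM2r// ler_nat//.
have ini := inpq _ (ltnW iM); have ini1 := inpq _ iM.
rewrite -(cross_add e' p (p + i%:R * st)) -IH ?(ltnW iM)//.
set y1 := pt e' (p + _); set y2 := pt e' (p + _).
have step : `|p + i%:R * st - (p + i.+1%:R * st)| < d'.
  by rewrite -natr1 mulrDl mul1r opprD addrACA subrr add0r opprD addrA subrr sub0r normrN ger0_norm.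
have : w y2 y1 = cross e z (e', p + i%:R * st, p + i.+1%:R * st).
  rewrite /w (@short_crossingsE _ _ _ [:: (e', p + i%:R * st, p + i.+1%:R * st)])//.
  - by rewrite /crossings big_seq1.
  - by split=> //=; move: ini ini1; lra.
  - by rewrite seg_len_cons /seg_len big_nil addr0/=; move: step; rewrite lt_min => /andP[].
move=> <-; rewrite -gE.
- by move: (g y1) (g y2) (g (pt e' p)) => g1 g2 g3; ring.
- exact: pqT.
- exact: pqT.
- by apply: ball_pt; move: step; rewrite lt_min => /andP[].
Qed.

End potential.

(** * Subdivisions into cells *)

Section consecutive_pairs.
Variable R : realType.
Implicit Types (a p q t : R) (s : seq R).

Lemma pairmap_consecutive a s p q : path.path <%R a s ->
  (p, q) \in pairmap pair a s ->
  [/\ p \in a :: s, q \in s, p < q & forall t, t \in a :: s -> ~~ (p < t < q)].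
Proof.
elim: s a => //= b s IH a /andP[ab bs]; rewrite inE => /predU1P[[-> ->]|/IH].
  rewrite !mem_head; split=> // t; rewrite !inE => /or3P[/eqP->|/eqP->|ts].
  - by rewrite ltxx.
  - by rewrite ltxx andbF.
  - by have /allP/(_ _ ts) := order_path_min lt_trans bs; rewrite andbC => bt; rewrite ltNge ltW.
move=> /(_ bs)[pb qs pq H]; split=> //; first by rewrite inE pb orbT.
  by rewrite inE qs orbT.
move=> t; rewrite inE => /predU1P[->|]; last exact: H.
have bp : b <= p.
  move: pb; rewrite inE => /predU1P[->//|ps].
  by have /allP/(_ _ ps)/ltW := order_path_min lt_trans bs.
by rewrite ltNge (le_trans (ltW ab)).
Qed.

Lemma pairmap_cover a s t : a < t <= last a s ->
  exists p q, (p, q) \in pairmap pair a s /\ p < t <= q.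
Proof.
elim: s a => [|b s IH] a /=; first by move=> /andP[/lt_le_trans /[apply]]; rewrite ltxx.
move=> /andP[at_ tl]; have [tb|bt] := leP t b.
  by exists a, b; rewrite mem_head at_ tb.
have [|p [q [pq tpq]]] := IH b; first by rewrite bt.
by exists p, q; rewrite inE pq orbT.
Qed.

Lemma pairmap_snd a s : [seq c.2 | c <- pairmap pair a s] = s.
Proof. by elim: s a => //= b s IH a; rewrite IH. Qed.

Lemma pairmap_fst a s : [seq c.1 | c <- pairmap pair a s] = belast a s.
Proof. by elim: s a => //= b s IH a; rewrite IH. Qed.

End consecutive_pairs.

Section subdivision.
Variables (R : realType) (G : multigraph R) (D : edge G -> seq R).
Local Notation X := (realization G).
Implicit Types (x y : X) (e : edge G) (p q t u : R) (F : set X).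

Definition breakpoints e : seq R :=
  sort <=%R (undup [seq t <- D e | 0 < t < len e]).

Definition edge_cells e : seq (R * R) :=
  pairmap pair 0 (rcons (breakpoints e) (len e)).

Definition cells : seq (segment G) :=
  [seq (e, c.1, c.2) | e <- enum (edge G), c <- edge_cells e].

Definition nodes : seq X :=
  [seq vpt v | v <- enum (vertex G)] ++
  [seq pt e t | e <- enum (edge G), t <- breakpoints e].

Definition mid (c : segment G) : X := pt c.1.1 ((c.1.2 + c.2) / 2).
Definition first_end (c : segment G) : X := pt c.1.1 c.1.2.
Definition last_end (c : segment G) : X := pt c.1.1 c.2.

Lemma mem_breakpoints e t : (t \in breakpoints e) = (t \in D e) && (0 < t < len e).
Proof. by rewrite mem_sort mem_undup mem_filter andbC. Qed.

Lemma breakpoints_uniq e : uniq (breakpoints e).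
Proof. by rewrite sort_uniq undup_uniq. Qed.

Lemma breakpoints_path e : path.path <%R 0 (rcons (breakpoints e) (len e)).
Proof.
rewrite rcons_path; apply/andP; split; last first.
  have := mem_last 0 (breakpoints e); rewrite inE => /predU1P[->|]; first exact: len_gt0.
  by rewrite mem_breakpoints => /and3P[].
rewrite path_min_sorted; last by apply/allP => t; rewrite mem_breakpoints => /and3P[].
by rewrite lt_sorted_uniq_le breakpoints_uniq sort_sorted//; exact: le_total.
Qed.

Lemma mem_cells e p q : ((e, p, q) \in cells) = ((p, q) \in edge_cells e).
Proof.
apply/allpairsPdep/idP => [[e' [[p' q'] [_ pq [-> -> ->]]]] //|pq].
by exists e, (p, q); rewrite mem_enum.
Qed.

Lemma mem_node_vpt v : vpt v \in nodes.
Proof. by rewrite mem_cat map_f// mem_enum. Qed.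

Lemma mem_node_breakpoint e t : t \in breakpoints e -> pt e t \in nodes.
Proof.
by move=> te; rewrite mem_cat; apply/orP; right; apply/allpairsPdep; exists e, t; rewrite mem_enum.
Qed.

Lemma nodeP x : x \in nodes ->
  (exists v, x = vpt v) \/ exists e t, t \in breakpoints e /\ x = pt e t.
Proof.
rewrite mem_cat => /orP[/mapP[v _ ->]|/allpairsPdep[e [t [_ te ->]]]]; first by left; exists v.
by right; exists e, t.
Qed.

Lemma cell_bounds e p q : (e, p, q) \in cells -> [/\ 0 <= p, p < q & q <= len e].
Proof.
rewrite mem_cells => /(pairmap_consecutive (breakpoints_path e))[+ + pq _].
rewrite inE !mem_rcons !inE => p0 q0; split=> //.
  case/or3P: p0 => [/eqP->//|/eqP ->|]; first exact/ltW/len_gt0.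
  by rewrite mem_breakpoints => /and3P[_ /ltW].
by case/orP: q0 => [/eqP->//|]; rewrite mem_breakpoints => /and3P[_ _ /ltW].
Qed.

Definition coordinates e := 0 :: rcons (breakpoints e) (len e).

Lemma node_coordinate e t : t \in coordinates e -> pt e t \in nodes.
Proof.
rewrite inE mem_rcons inE => /or3P[/eqP->|/eqP->|/mem_node_breakpoint//].
  by rewrite pt0 mem_node_vpt.
by rewrite pt_len mem_node_vpt.
Qed.

Lemma coordinate_node e t : 0 <= t <= len e -> pt e t \in nodes -> t \in coordinates e.
Proof.
move=> te /nodeP[[v /(pt_vpt te)]|[e' [t' [t'e E]]]].
  by rewrite !(inE, mem_rcons) => -[[-> _]|[-> _]]; rewrite eqxx ?orbT.
move: (t'e); rewrite mem_breakpoints => /andP[_ t'i].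
have [? ?] := pt_inj t'i te (esym E); subst e' t'.
by rewrite !(inE, mem_rcons) t'e !orbT.
Qed.

Lemma cell_coordinates e p q : (e, p, q) \in cells ->
  [/\ p \in coordinates e, q \in coordinates e &
      forall t, t \in coordinates e -> ~~ (p < t < q)].
Proof.
rewrite mem_cells => /(pairmap_consecutive (breakpoints_path e))[pc qc _ H].
by split=> //; rewrite inE qc orbT.
Qed.

Lemma cell_avoids e p q t : (e, p, q) \in cells -> t \in D e -> ~~ (p < t < q).
Proof.
move=> c tD; have [p0 pq ql] := cell_bounds c; have [_ _ H] := cell_coordinates c.
apply/negP => ptq; have /andP[pt_ tq] := ptq; have := H t; rewrite ptq => /(_ _)/negP; case=> //.
rewrite !(inE, mem_rcons) mem_breakpoints tD (le_lt_trans p0 pt_) (lt_le_trans tq ql).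
by rewrite !orbT.
Qed.

Lemma cell_ends c : c \in cells -> first_end c \in nodes /\ last_end c \in nodes.
Proof.
case: c => -[e p] q /cell_coordinates[pc qc _].
by split; exact: node_coordinate.
Qed.

Lemma cells_uniq : uniq cells.
Proof.
apply: allpairs_uniq_dep; first exact: enum_uniq.
  move=> e _; apply: (@map_uniq _ _ (fun c : R * R => c.2)); rewrite pairmap_snd rcons_uniq breakpoints_uniq.
  by rewrite mem_breakpoints ltxx !andbF.
by move=> [e [p q]] [e' [p' q']] _ _ /= [-> -> ->].
Qed.

Lemma nodes_uniq : uniq nodes.
Proof.
rewrite cat_uniq map_inj_uniq; last by move=> v w /(congr1 val)[].
rewrite enum_uniq/=; apply/andP; split.
  apply/hasPn => _ /allpairsPdep[e [t [_ te ->]]]; apply/negP => /mapP[v _ /esym].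
  by apply: vpt_neq_pt; move: te; rewrite mem_breakpoints => /andP[].
apply: allpairs_uniq_dep; first exact: enum_uniq.
  by move=> e _; exact: breakpoints_uniq.
move=> [e t] [e' t'] /allpairsPdep[e1 [t1 [_ te1 [E1 E2]]]] /allpairsPdep[e2 [t2 [_ te2 [E3 E4]]]] /=.
subst e1 e2 t1 t2; move: te1 te2; rewrite !mem_breakpoints => /andP[_ ti] /andP[_ /andP[t0 tl]].
by move=> /(pt_inj ti)[|-> -> //]; rewrite !ltW.
Qed.

Lemma point_in_cell x : x \in nodes \/
  exists e p q t, [/\ (e, p, q) \in cells, p < t < q & x = pt e t].
Proof.
case: (point_cases x) => [[v ->]|[e [t [/andP[t0 tl] ->]]]].
  by left; exact: mem_node_vpt.
have [|p [q [pq /andP[ptt tq]]]] := @pairmap_cover _ 0 (rcons (breakpoints e) (len e)) t.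
  by rewrite last_rcons t0 ltW.
have c : (e, p, q) \in cells by rewrite mem_cells.
have [->|tnq] := eqVneq t q.
  by left; have [] := cell_ends c.
by right; exists e, p, q, t; rewrite ptt lt_neqAle tnq.
Qed.

Lemma node_not_in_cell e p q t : (e, p, q) \in cells -> p < t < q -> pt e t \notin nodes.
Proof.
move=> c ptq; have [p0 pq ql] := cell_bounds c; have [_ _ H] := cell_coordinates c.
apply/negP => /coordinate_node; have /andP[pt_ tq] := ptq.
rewrite (ltW (le_lt_trans p0 pt_)) (ltW (lt_le_trans tq ql)) => /(_ isT)/H.
by rewrite ptq.
Qed.

Lemma cells_disjoint e p q t e' p' q' t' : (e, p, q) \in cells -> (e', p', q') \in cells ->
  p < t < q -> p' <= t' <= q' -> pt e t = pt e' t' -> (e, p, q) = (e', p', q').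
Proof.
move=> c c' /andP[pt_ tq] /andP[pt' tq'] E.
have [p0 pq ql] := cell_bounds c; have [p0' pq' ql'] := cell_bounds c'.
have [||? ?] := pt_inj _ _ E; [|by rewrite (le_trans p0')// (le_trans tq')|].
  by rewrite (le_lt_trans p0)// (lt_le_trans tq).
subst e' t'; have [pc qc H] := cell_coordinates c; have [pc' qc' H'] := cell_coordinates c'.
have := H _ pc'; have := H _ qc'; have := H' _ pc; have := H' _ qc.
rewrite !negb_and -!leNgt => h1 h2 h3 h4.
have -> : p' = p by apply/eqP; move: h1 h2 h3 h4 => /orP[]? /orP[]? /orP[]? /orP[]?; lra.
suff -> : q' = q by [].
by apply/eqP; move: h1 h2 h3 h4 => /orP[]? /orP[]? /orP[]? /orP[]?; lra.
Qed.


Lemma mid_in_cell p q : p < q -> p < (p + q) / 2 < q.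
Proof. by move=> pq; lra. Qed.

(** No other cell contains the midpoint of a cell. *)
Lemma cross_cell c c' : c \in cells -> c' \in cells ->
  cross c.1.1 ((c.1.2 + c.2) / 2) c' = (c' == c)%:Z.
Proof.
case: c c' => -[e p] q [[e' p'] q'] c c' /=.
have [_ pq _] := cell_bounds c; have [_ pq' _] := cell_bounds c'.
have /andP[pz zq] := mid_in_cell pq.
have [[-> -> ->]|ne] := eqVneq (e', p', q') (e, p, q).
  by rewrite /cross/= eqxx (ltW zq) leNgt pz.
rewrite /cross/=; case: eqP => // ee'.
have [zp'|p'z] := leP ((p + q) / 2) p'; first by rewrite (le_trans zp')// ltW.
have [zq'|//] := leP _ q'; move/eqP: ne => [].
apply/esym; apply: (@cells_disjoint _ _ _ ((p + q) / 2) _ _ _ ((p + q) / 2)) => //.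
- by rewrite pz zq.
- by rewrite (ltW p'z) zq'.
- by rewrite ee'.
Qed.

(** The unions of nodes and closed cells. *)
Definition cellular F := forall e p q t u, (e, p, q) \in cells ->
  p < t < q -> p <= u <= q -> F (pt e t) -> F (pt e u).

Lemma cellular_mid F c : cellular F -> c \in cells -> F (mid c) ->
  forall t, c.1.2 <= t <= c.2 -> F (pt c.1.1 t).
Proof.
case: c => -[e p] q Fc cin Fm t tpq.
have [_ /mid_in_cell mpq _] := cell_bounds cin.
exact: Fc cin mpq tpq Fm.
Qed.

Lemma cellular_ends F c : cellular F -> c \in cells -> F (mid c) ->
  F (first_end c) /\ F (last_end c).
Proof.
move=> Fc c_in Fm; have H := cellular_mid Fc c_in Fm.
by case: c c_in H {Fm} => -[e p] q /cell_bounds[_ /ltW pq _] H; split; apply: H; rewrite /= lexx pq.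
Qed.

Lemma cellularU F1 F2 : cellular F1 -> cellular F2 -> cellular (F1 `|` F2).
Proof.
by move=> c1 c2 e p q t u c ct cu [/(c1 _ _ _ _ _ c ct cu)|/(c2 _ _ _ _ _ c ct cu)]; [left|right].
Qed.

Lemma cellularI F1 F2 : cellular F1 -> cellular F2 -> cellular (F1 `&` F2).
Proof.
by move=> c1 c2 e p q t u c ct cu [/(c1 _ _ _ _ _ c ct cu) + /(c2 _ _ _ _ _ c ct cu)]; split.
Qed.

Lemma cellular_bigcup (I : Type) (P : set I) (F : I -> set X) :
  (forall i, P i -> cellular (F i)) -> cellular (\bigcup_(i in P) F i).
Proof.
by move=> Fc e p q t u c ct cu [i Pi Fi]; exists i => //; apply: Fc Pi _ _ _ _ _ c ct cu Fi.
Qed.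

Lemma cellular_bigcap (I : Type) (P : set I) (F : I -> set X) :
  (forall i, P i -> cellular (F i)) -> cellular (\bigcap_(i in P) F i).
Proof.
by move=> Fc e p q t u c ct cu Ft i Pi; apply: Fc Pi _ _ _ _ _ c ct cu (Ft i Pi).
Qed.

Lemma cellularT : cellular setT. Proof. by []. Qed.

Lemma cellular_node F : cellular F -> F !=set0 -> exists2 x, x \in nodes & F x.
Proof.
move=> Fc [x Fx]; case: (point_in_cell x) => [|[e [p [q [t [c tpq E]]]]]]; first by exists x.
exists (pt e p); first by have [] := cell_ends c.
have [_ pq _] := cell_bounds c.
by apply: Fc c tpq _ _; rewrite ?lexx ?ltW// -E.
Qed.

(** * Euler characteristics of unions of cells *)

Definition indic_int (P : Prop) : int := `[< P >]%:Z.

(** The Euler characteristic of a union of cells and nodes. As a signed count of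
    sample points it is defined, and additive, for all sets. *)
Definition chi F : int :=
  \sum_(x <- nodes) indic_int (F x) - \sum_(c <- cells) indic_int (F (mid c)).

Lemma indic_setU_setI (P Q : Prop) :
  indic_int (P \/ Q) + indic_int (P /\ Q) = indic_int P + indic_int Q.
Proof.
rewrite /indic_int asbool_or asbool_and.
by case: (asboolP P); case: (asboolP Q).
Qed.

Lemma chiUI F1 F2 : chi (F1 `|` F2) + chi (F1 `&` F2) = chi F1 + chi F2.
Proof.
rewrite /chi addrACA -opprD -!big_split/= [RHS]addrACA -opprD -!big_split/=.
by congr (_ - _); apply: eq_bigr => x _; exact: indic_setU_setI.
Qed.

Lemma chi_set0 : chi set0 = 0.
Proof. by rewrite /chi !big1 ?subrr// => x _; rewrite /indic_int asboolF. Qed.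

Lemma chi_setT : chi setT = graph_euler G.
Proof.
have E (T : Type) (s : seq T) : \sum_(x <- s) indic_int True = (size s)%:Z.
  by rewrite big_const_seq count_predT iter_addr_0 /indic_int asboolT// natz.
rewrite /chi !E /nodes /cells size_cat size_map -cardE !size_allpairs_dep.
rewrite !sumnE !big_map.
under [X in _ - Posz X]eq_bigr do rewrite size_pairmap size_rcons -addn1.
have -> : (\sum_(i <- Finite.enum (edge G)) (size (breakpoints i) + 1))%N =
    ((\sum_(i <- Finite.enum (edge G)) size (breakpoints i)) + #|edge G|)%N.
  by rewrite big_split/= sum1_size -enumT -cardE.
have cancel (a b m1 m2 : nat) : a = b -> (m1 + a)%N%:Z - (b + m2)%N%:Z = m1%:Z - m2%:Z by lia.
exact: cancel.
Qed.

(** Inclusion-exclusion, at each sample point. *)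
Lemma chi_inclusion_exclusion n (A : 'I_n -> set X) :
  chi (\bigcup_i A i) = \sum_(I : {set 'I_n} | I != finset.set0)
    (-1) ^+ #|I|.-1 * chi (inter A I).
Proof.
have pointwise x : indic_int ((\bigcup_i A i) x) = \sum_(I : {set 'I_n} | I != finset.set0)
    (-1) ^+ #|I|.-1 * indic_int (inter A I x).
  pose J := [set i | `[< A i x >]]%SET.
  transitivity ((J != finset.set0)%:R : int).
    rewrite natz /indic_int; congr (nat_of_bool _)%:Z.
    apply/asboolP/set0Pn => [[i _ Aix]|[i]]; first by exists i; rewrite inE; apply/asboolP.
    by rewrite inE => /asboolP; exists i.
  rewrite -(sum_euler_subsets J) big_mkcondr/=; apply: eq_bigr => I _.
  rewrite /indic_int; case: ifPn => [/fintype.subsetP IJ|IJ].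
    rewrite asboolT ?mulr1// => i /= iI.
    by have := IJ i iI; rewrite inE => /asboolP.
  rewrite asboolF ?mulr0// => AI; move/negP: IJ; apply; apply/fintype.subsetP => i iI.
  by rewrite inE; apply/asboolP; exact: AI.
rewrite /chi; under eq_bigr do rewrite pointwise.
under [X in _ - X]eq_bigr do rewrite pointwise.
rewrite exchange_big [X in _ - X]exchange_big -sumrB; apply: eq_bigr => I _.
by rewrite -!mulr_sumr -mulrBr.
Qed.

Lemma sum_indic_filter (T : Type) (s : seq T) (P : T -> Prop) :
  \sum_(x <- s) indic_int (P x) = (size [seq x <- s | `[< P x >]])%:Z.
Proof.
rewrite size_filter -sum1_count -natz natr_sum [RHS]big_mkcond/=.
by apply: eq_bigr => x _; rewrite /indic_int; case: ifP.
Qed.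

Lemma chi_sizes F : chi F =
  (size [seq x <- nodes | `[< F x >]])%:Z - (size [seq c <- cells | `[< F (mid c) >]])%:Z.
Proof. by rewrite /chi !sum_indic_filter. Qed.

Lemma filter_ends F : cellular F -> forall c, c \in [seq c <- cells | `[< F (mid c) >]] ->
  first_end c \in [seq x <- nodes | `[< F x >]] /\ last_end c \in [seq x <- nodes | `[< F x >]].
Proof.
move=> Fc c; rewrite mem_filter => /andP[/asboolP Fm cin].
have [n1 n2] := cell_ends cin; have [F1 F2] := cellular_ends Fc cin Fm.
by rewrite !mem_filter n1 n2 !andbT; split; apply/asboolP.
Qed.

(** The first cohomology of F vanishes: each cell is the coboundary of some
    function on the nodes of F. *)
Definition has_cuts F := forall c, c \in cells -> F (mid c) -> exists f : X -> int,
  forall c', c' \in cells -> F (mid c') -> f (last_end c') - f (first_end c') = (c' == c)%:R.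

Lemma has_cuts_sub F F' : F `<=` F' -> has_cuts F' -> has_cuts F.
Proof.
move=> FF' cuts c cin /FF' Fm; have [f fP] := cuts c cin Fm.
by exists f => c' c'in /FF' Fm'; exact: fP.
Qed.

(** F is a forest, in which each component has one node more than it has cells. *)
Lemma chi_has_cuts F : cellular F -> has_cuts F -> F !=set0 -> 1 <= chi F.
Proof.
move=> Fc cuts /(cellular_node Fc)[x xn Fx]; rewrite chi_sizes.
have := card_edges_lt_vertices (filter_uniq _ nodes_uniq) (filter_uniq _ cells_uniq) (filter_ends Fc).
move=> /(_ _ _)/=; set E := size _; set V := size _ => H.
have : (E < V)%N; last by lia.
apply: H => [c|].
  rewrite mem_filter => /andP[/asboolP Fm cin]; have [f fP] := cuts c cin Fm.
  by exists f => c'; rewrite mem_filter => /andP[/asboolP Fm' c'in]; exact: fP.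
apply/eqP => V0; have : x \in [seq x <- nodes | `[< F x >]].
  by rewrite mem_filter xn andbT; apply/asboolP.
by rewrite V0.
Qed.

Lemma chi_has_cuts_ge0 F : cellular F -> has_cuts F -> 0 <= chi F.
Proof.
move=> Fc cuts; have [->|/set0P F0] := eqVneq F set0; first by rewrite chi_set0.
by apply: le_trans (chi_has_cuts Fc cuts F0).
Qed.

(** The cut of a cell counts the crossings of its midpoint. *)
Lemma contractible_has_cuts T : compact T -> contractible R T -> cellular T -> has_cuts T.
Proof.
move=> cT kT Tc c cin Tm.
have zin : 0 < (c.1.2 + c.2) / 2 <= len c.1.1.
  case: c cin {Tm} => -[e p] q /cell_bounds[p0 pq ql]/=.
  by have /andP[pz zq] := mid_in_cell pq; rewrite (le_lt_trans p0 pz) (le_trans (ltW zq)).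
have [f fP] := contractible_potential zin cT kT.
exists f => c' c'in Tm'; rewrite natz -(cross_cell cin c'in).
have H := cellular_mid Tc c'in Tm'.
case: c' c'in {Tm'} H => -[e' p'] q' c'in H.
by have [p0 pq ql] := cell_bounds c'in; apply: fP => //; exact: ltW.
Qed.


Lemma closed_cell_cases c x : c \in cells -> (pt c.1.1 @` `[c.1.2, c.2]) x ->
  (x \in nodes /\ (x = first_end c \/ x = last_end c)) \/
  exists2 t, c.1.2 < t < c.2 & x = pt c.1.1 t.
Proof.
move=> cin [t /=]; rewrite in_itv/= => /andP[pt_ tq] <-.
have [n1 n2] := cell_ends cin.
have [->|tp] := eqVneq t c.1.2; first by left; split=> //; left.
have [->|tq'] := eqVneq t c.2; first by left; split=> //; right.
by right; exists t; rewrite // !lt_neqAle pt_ tq tq' eq_sym tp.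
Qed.

Lemma closed_bigcup_seq (I : choiceType) (s : seq I) (P : I -> Prop) (K : I -> set X) :
  (forall i, i \in s -> closed (K i)) -> closed (\bigcup_(i in [set i | i \in s /\ P i]) K i).
Proof.
elim: s => [|i s IH] Kc.
  by rewrite (_ : [set _ | _] = set0) ?bigcup_set0; [exact: closed0|apply/seteqP; split=> i []].
pose Ki := if `[< P i >] then K i else set0.
have -> : \bigcup_(j in [set j | j \in i :: s /\ P j]) K j =
    Ki `|` \bigcup_(j in [set j | j \in s /\ P j]) K j.
  apply/seteqP; split => [x [j [+ Pj] Kj]|x [|[j [js Pj] Kj]]].
  - rewrite inE => /predU1P[E|js]; last by right; exists j.
    by left; rewrite /Ki -E asboolT.
  - rewrite /Ki; case: asboolP => // Pi Kix; exists i => //; split=> //; exact: mem_head.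
  - by exists j => //; split => //; rewrite inE js orbT.
apply: closedU.
  by rewrite /Ki; case: ifP => _; [apply: Kc; exact: mem_head|exact: closed0].
by apply: IH => j js; apply: Kc; rewrite inE js orbT.
Qed.

(** A function of the nodes of F that does not change along the cells of F
    splits F into two closed sets. *)
Lemma connected_cells_const (V : eqType) (f : X -> V) F : cellular F -> connected F ->
  (forall c, c \in cells -> F (mid c) -> f (last_end c) = f (first_end c)) ->
  forall x y, x \in nodes -> y \in nodes -> F x -> F y -> f x = f y.
Proof.
move=> Fc Fconn fc x0 y0 x0n y0n Fx0 Fy0.
pose cl (c : segment G) : set X := pt c.1.1 @` `[c.1.2, c.2].
(* K true and K false are the unions of the nodes and closed cells on which f
   takes the value f x0, or another value. *)
pose K b : set X :=
  \bigcup_(x in [set x | x \in nodes /\ F x /\ (f x == f x0) = b]) [set x] `|`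
  \bigcup_(c in [set c | c \in cells /\ F (mid c) /\ (f (first_end c) == f x0) = b]) cl c.
have K_closed b : closed (K b).
  apply: closedU.
    apply: (@closed_bigcup_seq _ nodes (fun x => F x /\ (f x == f x0) = b)) => x _.
    exact: accessible_closed_set1 (hausdorff_accessible (@realization_hausdorff R G)) x.
  apply: (@closed_bigcup_seq _ cells (fun c => F (mid c) /\ (f (first_end c) == f x0) = b)) => c _.
  exact: closed_seg.
have KF b : K b `<=` F.
  move=> x [[y [_ [Fy _]] ->//]|[c [cin [Fm _]] [t]]].
  by rewrite /= in_itv => tpq <-; exact: cellular_mid Fm _ tpq.
have K_node b x : x \in nodes -> K b x -> (f x == f x0) = b.
  move=> xn [[y [_ [_ <-]] ->//]|[c [cin [Fm <-]] /(closed_cell_cases cin)]].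
  case=> [[_ [->//|->]]|[t tpq E]]; first by rewrite fc.
  move: xn; rewrite E => /negPn; rewrite (node_not_in_cell _ tpq)//.
  by case: (c) cin => -[].
have K_cell b e p q t : (e, p, q) \in cells -> p < t < q -> K b (pt e t) ->
    (f (pt e p) == f x0) = b.
  move=> cin tpq [[y [yn _] E]|[[[e' p'] q'] [c'in [_ <-]] [t']]].
    by move: yn; rewrite -E => /negPn; rewrite (node_not_in_cell cin tpq).
  rewrite /= in_itv/= => t'pq /esym E.
  by have [-> -> _] := cells_disjoint cin c'in tpq t'pq E.
have K_disj x : K true x -> K false x -> False.
  move=> k1 k2; case: (point_in_cell x) => [xn|[e [p [q [t [cin tpq E]]]]]].
    by have := K_node _ _ xn k1; rewrite (K_node _ _ xn k2).
  rewrite E in k1 k2; have := K_cell _ _ _ _ _ cin tpq k1.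
  by rewrite (K_cell _ _ _ _ _ cin tpq k2).
have K_cover x : F x -> K true x \/ K false x.
  move=> Fx; case: (point_in_cell x) => [xn|[e [p [q [t [cin tpq E]]]]]].
    by case E : (f x == f x0); [left|right]; left; exists x.
  have Fm : F (mid (e, p, q)).
    have [_ pq _] := cell_bounds cin; have /andP[mp mq] := mid_in_cell pq.
    by apply: Fc cin tpq _ _; rewrite ?(ltW mp) ?(ltW mq)// -E.
  have clx : cl (e, p, q) x by exists t; rewrite // /= in_itv/=; move/andP: tpq => [/ltW-> /ltW->].
  by case E' : (f (pt e p) == f x0); [left|right]; right; exists (e, p, q).
have KTF : K true = F.
  apply: Fconn.
  - by exists x0; left; exists x0 => //; split=> //; split=> //; exact: eqxx.
  - exists (~` K false); first exact/closed_openC/K_closed.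
    apply/seteqP; split => [x Kx|x [Fx nKx]]; last by case: (K_cover x Fx).
    by split; [exact: KF Kx|move=> ?; exact: K_disj Kx _].
  - exists (K true) => //; apply/seteqP; split => [x Kx|x []//].
    by split=> //; exact: KF Kx.
by apply/esym/eqP; apply: K_node => //; rewrite KTF.
Qed.

Lemma chi_connected F : cellular F -> connected F -> chi F <= 1.
Proof.
move=> Fc Fconn; rewrite chi_sizes.
suff : (size [seq x <- nodes | `[< F x >]] <= (size [seq c <- cells | `[< F (mid c) >]]).+1)%N by lia.
apply: (card_vertices_le_edges (filter_uniq _ nodes_uniq) (filter_ends Fc)).
move=> f fc x y; rewrite !mem_filter => /andP[/asboolP Fx xn] /andP[/asboolP Fy yn].
apply: connected_cells_const Fc Fconn _ _ _ xn yn Fx Fy => c cin Fm.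
by apply: fc; rewrite mem_filter cin andbT; apply/asboolP.
Qed.

Lemma chi_contractible T : compact T -> contractible R T -> cellular T -> chi T = 1.
Proof.
move=> cT kT Tc; apply/eqP; rewrite eq_le chi_connected//=; last exact: contractible_connected.
apply: chi_has_cuts Tc (contractible_has_cuts cT kT Tc) _.
by have [a Ta _] := kT; exists a.
Qed.

Let incidence x c : int := (x == first_end c)%:Z + (x == last_end c)%:Z.

Let sum_incidence c : c \in cells -> \sum_(x <- nodes) incidence x c = 2.
Proof.
move=> /cell_ends[n1 n2].
have one y : y \in nodes -> \sum_(x <- nodes) (x == y)%:Z = 1.
  move=> yn; rewrite (bigD1_seq y)//= ?nodes_uniq// eqxx big1 ?addr0// => x /negbTE->//.
by rewrite big_split/= !one.
Qed.

Let sum_cells (F : segment G -> int) :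
  \sum_(c <- cells) F c = \sum_e \sum_(c <- edge_cells e) F (e, c.1, c.2).
Proof. by rewrite /cells big_allpairs_dep big_enum. Qed.

Let degree_le v : (degree v)%:Z <= \sum_(c <- cells) incidence (vpt v) c.
Proof.
rewrite sum_cells /degree PoszD -!sum1_card -!natz !natr_sum.
rewrite big_mkcond [X in _ + X]big_mkcond -big_split/=; apply: ler_sum => e _.
rewrite big_split/=; apply: lerD.
  rewrite -(big_map (fun c : R * R => c.1) xpredT (fun t => (vpt v == pt e t)%:Z)).
  rewrite pairmap_fst belast_rcons big_cons pt0 inE.
  rewrite (_ : (vpt v == vpt (src e)) = (src e == v)); last first.
    by apply/eqP/eqP => [/(congr1 val)[]|->].
  by case: eqP => _; rewrite ?lerDl; apply: sumr_ge0.
rewrite -(big_map (fun c : R * R => c.2) xpredT (fun t => (vpt v == pt e t)%:Z)).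
rewrite pairmap_snd -cats1 big_cat/= big_seq1 pt_len inE.
rewrite (_ : (vpt v == vpt (tgt e)) = (tgt e == v)); last first.
  by apply/eqP/eqP => [/(congr1 val)[]|->].
by case: eqP => _; rewrite ?lerDr; apply: sumr_ge0.
Qed.

Let breakpoint_incidence e t : t \in breakpoints e ->
  2 <= \sum_(c <- cells) incidence (pt e t) c.
Proof.
move=> te.
have /mapP[[p t1] /= c1 E1] : t \in [seq c.2 | c <- edge_cells e].
  by rewrite pairmap_snd mem_rcons inE te orbT.
have /mapP[[t2 q] /= c2 E2] : t \in [seq c.1 | c <- edge_cells e].
  by rewrite pairmap_fst belast_rcons inE te orbT.
subst t1 t2; rewrite -!mem_cells in c1 c2.
rewrite big_split/= (bigD1_seq _ c2 cells_uniq)/= [X in _ + X](bigD1_seq _ c1 cells_uniq)/=.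
rewrite /first_end /last_end/= !eqxx.
set S1 := \sum_(_ <- _ | _) _; set S2 := \sum_(_ <- _ | _) _.
have : 0 <= S1 by apply: sumr_ge0.
have : 0 <= S2 by apply: sumr_ge0.
by lia.
Qed.

(** Without leaves, each node of the complement meets at least two of its cells,
    and by connectedness a node of Y meets one of them. Counting the ends of its
    cells, the complement has negative Euler characteristic. *)
Lemma chi_proper_gt Y : connected [set: X] -> leaves G = finset.set0 ->
  cellular Y -> Y !=set0 -> Y <> setT -> graph_euler G < chi Y.
Proof.
move=> Xconn Xleaf Yc Y0 YT; pose Z := ~` Y.
have Z0 : Z !=set0.
  by apply/set0P/eqP => /(congr1 (@setC _)); rewrite setCK setC0.
have ZY c : c \in cells -> Z (mid c) -> forall P, (Z (first_end c) -> Z (last_end c) -> P) ->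
   (forall x, x \in nodes -> Y x -> 0 < incidence x c -> P) -> P.
  move=> cin Zc P H1 H2; have [n1 n2] := cell_ends cin.
  have [Y1|Z1] := pselect (Y (first_end c)); first by apply: (H2 _ n1 Y1); rewrite /incidence eqxx; case: eqP.
  have [Y2|Z2] := pselect (Y (last_end c)); first by apply: (H2 _ n2 Y2); rewrite /incidence eqxx; case: eqP.
  exact: H1.
have const (f : X -> bool) : (forall c, c \in cells -> f (last_end c) = f (first_end c)) ->
    {in nodes &, forall x y, f x = f y}.
  move=> fc x y xn yn.
  by apply: (connected_cells_const cellularT Xconn _ xn yn I I) => c cin _; exact: fc.
have [y yn Yy] := cellular_node Yc Y0.
have node_or_mid : (exists2 x, x \in nodes & Z x) \/ (exists2 c, c \in cells & Z (mid c)).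
  have [x Zx] := Z0; case: (point_in_cell x) => [xn|[e [p [q [t [cin /andP[pt_ tq] E]]]]]].
    by left; exists x.
  right; exists (e, p, q) => // Ym; apply: Zx; rewrite E.
  by apply: (cellular_mid Yc cin Ym); rewrite /= (ltW pt_) (ltW tq).
have [x [c [xn cin Yx Zc xc]]] : exists x c,
    [/\ x \in nodes, c \in cells, Y x, Z (mid c) & 0 < incidence x c].
  apply: contrapT => H.
  have noinc c : c \in cells -> Z (mid c) -> Z (first_end c) /\ Z (last_end c).
    move=> cin Zc; apply: (ZY c cin Zc); first by split.
    by move=> x xn Yx xc; exfalso; apply: H; exists x, c.
  have fc c : c \in cells -> `[< Y (last_end c) >] = `[< Y (first_end c) >].
    move=> cin; have [Yc'|Zc] := pselect (Y (mid c)).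
      by have [Y1 Y2] := cellular_ends Yc cin Yc'; rewrite !asboolT.
    by have [Z1 Z2] := noinc c cin Zc; rewrite !asboolF.
  have [x xn Zx] : exists2 x, x \in nodes & Z x.
    case: node_or_mid => // -[c cin Zc]; exists (first_end c).
      by have [] := cell_ends cin.
    by have [] := noinc c cin Zc.
  by have := const (fun x => `[< Y x >]) fc x y xn yn; rewrite (asboolF Zx) (asboolT Yy).
have deg2 v : v \in nodes -> Z v -> 2 <= \sum_(c <- cells) incidence v c.
  move=> /nodeP[[w ->]|[e [t [te ->]]]] Zv; last exact: breakpoint_incidence.
  have : w \notin leaves G by rewrite Xleaf inE.
  rewrite inE => d1; apply: le_trans (degree_le w); rewrite lez_nat.
  suff : degree w != 0%N by move: d1; case: (degree w) => [|[|]].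
  apply: contra_notN Zv => d0.
  have isol c1 : c1 \in cells -> (first_end c1 == vpt w) = false /\ (last_end c1 == vpt w) = false.
    have srcw e : src e <> w.
      move=> ew; move: d0; rewrite addn_eq0 !cards_eq0 => /andP[/eqP/setP/(_ e)].
      by rewrite !inE ew eqxx.
    have tgtw e : tgt e <> w.
      move=> ew; move: d0; rewrite addn_eq0 !cards_eq0 => /andP[_ /eqP/setP/(_ e)].
      by rewrite !inE ew eqxx.
    case: c1 => -[e p] q /cell_bounds[p0 /ltW pq ql].
    by split; apply/eqP => /pt_vpt; rewrite ?p0 ?ql ?(le_trans pq)// ?(le_trans p0)// => /(_ isT)[[_ /srcw]|[_ /tgtw]].
  have : (vpt w == vpt w) = (y == vpt w).
    by apply: (const (fun x => x == vpt w)) => //; [move=> c1 /isol[-> ->]|exact: mem_node_vpt].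
  by rewrite eqxx => /esym/eqP <-.
have chiYZ : chi Y + chi Z = graph_euler G.
  by rewrite -chiUI /Z setUv setICr chi_set0 addr0 chi_setT.
suff : chi Z < 0 by rewrite -chiYZ; lia.
(* Each cell has two ends, so that its contribution can be distributed over
   its ends. *)
have double : chi Z * 2 = \sum_(x <- nodes) (indic_int (Z x) * 2 -
    \sum_(c <- cells) incidence x c * indic_int (Z (mid c))).
  rewrite sumrB exchange_big/= /chi mulrBl !mulr_suml; congr (_ - _).
  by apply: eq_big_seq => c' c'in; rewrite -mulr_suml sum_incidence// mulrC.
suff : chi Z * 2 < 0 by lia.
rewrite double (bigD1_seq _ xn nodes_uniq)/= -[ltRHS]addr0 ltr_leD//.
  rewrite /indic_int asboolF// mul0r sub0r oppr_lt0 (bigD1_seq _ cin cells_uniq)/=.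
  rewrite ltr_pwDl//; first by rewrite asboolT// mulr1.
  by apply: sumr_ge0 => c' _; rewrite mulr_ge0.
rewrite big_seq_cond; apply: sumr_le0 => x' /andP[x'n _]; rewrite subr_le0.
have [Yx'|Zx'] := pselect (Y x').
  rewrite /indic_int asboolF ?mul0r; last by move=> /(_ Yx').
  by apply: sumr_ge0 => c' _; rewrite mulr_ge0.
rewrite {1}/indic_int asboolT// mul1r; apply: le_trans (deg2 _ x'n Zx') _.
rewrite big_seq [leRHS]big_seq; apply: ler_sum => c' c'in.
have [Yc'|Zc'] := pselect (Y (mid c')); last by rewrite /indic_int asboolT// mulr1.
have [Y1 Y2] := cellular_ends Yc c'in Yc'.
rewrite /incidence; case: eqP => [E|_]; first by case: Zx'; rewrite E.
by case: eqP => [E|_]; [case: Zx'; rewrite E|rewrite addr0 mul0r].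
Qed.

End subdivision.

(** * Subdivisions that are compatible with connected sets *)

Section tame_sets.
Variables (R : realType) (G : multigraph R).
Local Notation X := (realization G).
Implicit Types (F : set X) (e : edge G) (t u : R).

Lemma open_seg e t0 t1 : 0 <= t0 -> t1 <= len e -> open (pt e @` `]t0, t1[).
Proof.
move=> t00 t1l; rewrite openE => _ [t /= + <-]; rewrite in_itv/= => /andP[t0t tt1].
apply/nbhs_ballP; exists (Num.min (t - t0) (t1 - t)).
  by rewrite /= lt_min !subr_gt0 t0t.
move=> y /ballP[s sP]; rewrite lt_min => /andP[s1 s2].
have [|||u [ue tu ->]] := seg_path_interior _ sP; [lra|lra|lra|].
exists u => //=; rewrite in_itv/=.
move: (le_lt_trans tu s1) (le_lt_trans tu s2); rewrite !ltr_norml; lra.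
Qed.

(** The part of F in the segment is open and closed in F, since the segment is
    open without its ends and closed with them. *)
Lemma connected_in_seg F e t0 t t1 : connected F -> 0 < t0 -> t0 < t -> t < t1 ->
  t1 < len e -> ~ F (pt e t0) -> F (pt e t) -> ~ F (pt e t1) ->
  forall x, F x -> exists2 u, t0 < u < t1 & x = pt e u.
Proof.
move=> Fconn t00 t0t tt1 t1l F0 Ft F1 x Fx.
pose B := F `&` pt e @` `]t0, t1[.
suff BF : B = F.
  by move: Fx; rewrite -{1}BF => -[_ [u /= + <-]]; rewrite in_itv/= => ui; exists u.
apply: Fconn.
- by exists (pt e t); split=> //; exists t; rewrite //= in_itv/= t0t.
- by exists (pt e @` `]t0, t1[) => //; apply: open_seg; exact: ltW.
- exists (pt e @` `[t0, t1]); first exact: closed_seg.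
  apply/seteqP; split => [y [Fy [u /=]]|y [Fy [u /=]]]; rewrite in_itv/= => /andP[t0u ut1] uy.
    by split=> //; exists u; rewrite //= in_itv/= !ltW.
  split=> //; exists u => //=; rewrite in_itv/= !lt_neqAle t0u ut1 !andbT.
  by apply/andP; split; apply/eqP => E; [apply: F0; rewrite E uy|apply: F1; rewrite -E uy].
Qed.

(** Membership in a connected set changes along an edge only at the ends of the
    part of the edge inside the set and of the part outside the set. *)
Lemma connected_tame F e : connected F -> exists D : seq R,
  forall t u, 0 < t -> t < u -> u < len e ->
    `[< F (pt e t) >] != `[< F (pt e u) >] -> exists2 b, b \in D & t <= b <= u.
Proof.
move=> Fconn; pose I := [set t | 0 < t < len e /\ F (pt e t)].
pose O := [set t | 0 < t < len e /\ ~ F (pt e t)].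
(* If none of these points separates t from u, the part outside the set extends
   beyond t or u, so that the set is confined between two points of it, and then
   the part inside the set has an end between t and u. *)
exists [:: inf I; sup I; inf O; sup O] => t u t0 tu ul tuF.
have ti : 0 < t < len e by rewrite t0 (lt_trans tu).
have ui : 0 < u < len e by rewrite (lt_trans t0 tu) ul.
have I0 : has_lbound I by exists 0 => x [/andP[/ltW]].
have I1 : has_ubound I by exists (len e) => x [/andP[_ /ltW]].
have O0 : has_lbound O by exists 0 => x [/andP[/ltW]].
have O1 : has_ubound O by exists (len e) => x [/andP[_ /ltW]].
apply: contrapT => H.
have noD b : b \in [:: inf I; sup I; inf O; sup O] -> t <= b -> u < b.
  by move=> bD tb; rewrite ltNge; apply/negP => bu; apply: H; exists b; rewrite ?tb.
have noD' b : b \in [:: inf I; sup I; inf O; sup O] -> b <= u -> b < t.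
  by move=> bD bu; rewrite ltNge; apply/negP => tb; apply: H; exists b; rewrite ?tb.
have [Ft|Ft] := pselect (F (pt e t)); have [Fu|Fu] := pselect (F (pt e u)).
- by move: tuF; rewrite !asboolT.
- have Ou : O u by [].
  have /inf_lt : inf O < t by apply: noD'; rewrite ?inE ?eqxx ?orbT//; exact: ge_inf Ou.
  move=> /(_ (ex_intro _ u Ou))[a [/andP[a0 al] Fa] at_].
  have FI := connected_in_seg Fconn a0 at_ tu ul Fa Ft Fu.
  have : u < sup I by apply: noD; rewrite ?inE ?eqxx ?orbT//; exact: ub_le_sup.
  rewrite ltNge => /negP; apply; apply: ge_sup; first by exists t.
  move=> x [xi /FI[u' /andP[au' u'u]]] /(pt_inj xi)[|_ ->]; last exact: ltW.
  by rewrite (ltW (lt_trans a0 au')) (ltW (lt_trans u'u ul)).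
- have Ot : O t by [].
  have /sup_gt : u < sup O by apply: noD; rewrite ?inE ?eqxx ?orbT//; exact: ub_le_sup.
  move=> /(_ (ex_intro _ t Ot))[a [/andP[a0 al] Fa] ua].
  have FI := connected_in_seg Fconn t0 tu ua al Ft Fu Fa.
  have : inf I < t by apply: noD'; rewrite ?inE ?eqxx ?orbT//; exact: ge_inf.
  rewrite ltNge => /negP; apply; apply: lb_le_inf; first by exists u.
  move=> x [xi /FI[u' /andP[tu' u'a]]] /(pt_inj xi)[|_ ->]; last exact: ltW.
  by rewrite (ltW (lt_trans t0 tu')) (ltW (lt_trans u'a al)).
- by move: tuF; rewrite !asboolF.
Qed.

Lemma closed_fills_seg F e p q : closed F -> p < q ->
  (forall t, p < t < q -> F (pt e t)) -> forall u, p <= u <= q -> F (pt e u).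
Proof.
move=> Fc pq H u /andP[pu uq]; apply: contrapT => nFu.
have /nbhs_ballP[d /= d0 dP] : nbhs u (pt e @^-1` (~` F)).
  by apply: continuous_pt; apply: open_nbhs_nbhs; split=> //; exact: closed_openC.
have [t [tpq tu]] : exists t, p < t < q /\ `|u - t| < d.
  have d1 : 0 < Num.min (d / 2) ((q - p) / 4) by rewrite lt_min !divr_gt0// subr_gt0.
  have := d1; set d' := Num.min _ _ => d'0.
  have [h1 h2] : d' <= d / 2 /\ d' <= (q - p) / 4 by rewrite /d' !ge_min !lexx orbT.
  have [um|mu] := leP u ((p + q) / 2).
    by exists (u + d'); rewrite opprD addrA subrr sub0r normrN gtr0_norm//; split; lra.
  by exists (u - d'); rewrite opprB addrCA subrr addr0 gtr0_norm//; split; lra.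
exact: dP tu (H t tpq).
Qed.

Lemma tame_cellular (D : edge G -> seq R) F : closed F ->
  (forall e t u, 0 < t -> t < u -> u < len e ->
    `[< F (pt e t) >] != `[< F (pt e u) >] -> exists2 b, b \in D e & t <= b <= u) ->
  cellular D F.
Proof.
move=> Fc tame e p q t u cin tpq upq Ft.
have [p0 pq ql] := cell_bounds cin.
apply: (closed_fills_seg Fc pq) upq => {}u upq.
have same a b : p < a -> a < b -> b < q -> `[< F (pt e a) >] = `[< F (pt e b) >].
  move=> pa ab bq; apply: contrapT => /eqP/tame[|//||c cD /andP[ac cb]].
  - exact: le_lt_trans pa.
  - exact: lt_le_trans ql.
  by have := cell_avoids cin cD; rewrite (lt_le_trans pa)// (le_lt_trans cb).
have /andP[pt_ tq] := tpq; have /andP[pu uq] := upq.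
apply/asboolP; case: (ltgtP t u) => [tu|ut|<-]; last exact/asboolP.
  by rewrite -(same t u)//; exact/asboolP.
by rewrite (same u t)//; exact/asboolP.
Qed.

Lemma common_subdivision (I : finType) (A : I -> set X) (D0 : edge G -> seq R) :
  (forall i, closed (A i)) -> (forall i, connected (A i)) ->
  exists D, (forall e, {subset D0 e <= D e}) /\ forall i, cellular D (A i).
Proof.
move=> Ac Aconn.
pose Di e i := sval (cid (connected_tame e (Aconn i))).
exists (fun e => D0 e ++ flatten [seq Di e i | i <- enum I]); split=> [e t tD|i].
  by rewrite mem_cat tD.
apply: tame_cellular => // e t u t0 tu ul tuF.
have [b bD tbu] := svalP (cid (connected_tame e (Aconn i))) t u t0 tu ul tuF.
exists b => //; rewrite mem_cat; apply/orP; right.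
by apply/flatten_mapP; exists i; rewrite // mem_enum.
Qed.

End tame_sets.

(** * The Euler characteristic of the nerve of a good covering *)

Section good_coverings.
Variables (R : realType) (G : multigraph R).
Local Notation X := (realization G).

Lemma compact_closed_realization (F : set X) : compact F -> closed F.
Proof. by apply: compact_closed; exact: realization_hausdorff. Qed.

Variables (n : nat) (A : 'I_n -> set X).
Hypothesis A_compact : forall i, compact (A i).
Hypothesis A_good : forall I : {set 'I_n}, I != finset.set0 ->
  inter A I !=set0 -> contractible R (inter A I).

Lemma inter_compact I : I != finset.set0 -> compact (inter A I).
Proof.
move=> I0; apply: (subclosed_compact _ (@realization_compact R G)) => //.
by apply: closed_bigI => i _; exact: compact_closed_realization (@A_compact i).
Qed.

Lemma inter_set1 i : inter A [set i]%SET = A i.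
Proof.
apply/seteqP; split => [x /(_ i)|x Ax j /=]; first by apply; rewrite /= inE.
by rewrite inE => /eqP ->.
Qed.

Lemma good_single i : A i !=set0 -> contractible R (A i).
Proof. by rewrite -inter_set1; apply: A_good; apply/set0Pn; exists i; rewrite inE. Qed.

Lemma good_connected i : connected (A i).
Proof.
have [->|/set0P Ai] := eqVneq (A i) set0; first exact: connected0.
exact/contractible_connected/good_single.
Qed.

(** In the inclusion-exclusion formula each nonempty intersection contributes
    the Euler characteristic 1 of a tree. *)
Lemma chi_nerve_union (D : edge G -> seq R) : (forall i, cellular D (A i)) ->
  chi D (\bigcup_i A i) = faces_euler (nerve A).
Proof.
move=> Ac; rewrite chi_inclusion_exclusion /faces_euler [LHS]big_mkcond [RHS]big_mkcond/=.
apply: eq_bigr => I _; rewrite inE; case: ifP => //= I0.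
case: asboolP => [AI|nAI].
  by rewrite chi_contractible ?mulr1//;
    [exact: inter_compact|exact: A_good|apply: cellular_bigcap => i _; exact: Ac].
have -> : inter A I = set0 by apply/eqP; apply/negPn/negP => /set0P.
by rewrite chi_set0 mulr0.
Qed.

(** Adding a contractible set raises the Euler characteristic by at most one,
    since the Euler characteristic of a part of a tree is not negative. *)
Lemma chi_union_le (D : edge G -> seq R) (s : seq 'I_n) : (forall i, cellular D (A i)) ->
  chi D (\bigcup_(i in [set` s]) A i) <= (size s)%:Z.
Proof.
move=> Ac; elim: s => [|i s IH] /=.
  by rewrite (_ : [set` [::]] = set0) ?bigcup_set0 ?chi_set0// -subset0 => x.
have -> : \bigcup_(j in [set` i :: s]) A j = A i `|` \bigcup_(j in [set` s]) A j.
  by rewrite !bigcup_seq big_cons.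
set U := \bigcup_(j in _) _; have Uc : cellular D U by apply: cellular_bigcup => j _; exact: Ac.
have UI := chiUI D (A i) U.
have [Ai0|/set0P Ai] := eqVneq (A i) set0.
  by rewrite Ai0 set0U; apply: le_trans IH _; rewrite lez_nat.
have cuts : has_cuts D (A i) by apply: contractible_has_cuts => //; exact: good_single.
have I_ge0 : 0 <= chi D (A i `&` U).
  apply: chi_has_cuts_ge0; first exact: cellularI.
  by apply: has_cuts_sub cuts => x [].
have Ai1 : chi D (A i) = 1 by apply: chi_contractible => //; exact: good_single.
by rewrite -/U in IH; rewrite Ai1 in UI; lia.
Qed.

Lemma nerve_euler_range : connected [set: X] -> leaves G = finset.set0 ->
  (0 <= graph_euler G -> \bigcup_i A i !=set0) ->
  graph_euler G <= faces_euler (nerve A) <= n%:Z /\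
  ([set: X] `<=` \bigcup_i A i <-> faces_euler (nerve A) = graph_euler G).
Proof.
move=> Xconn Xleaf A0.
have [D [_ Ac]] := common_subdivision (fun=> [::]) (fun i => compact_closed_realization (@A_compact i)) good_connected.
have Uc : cellular D (\bigcup_i A i) by apply: cellular_bigcup => i _; exact: Ac.
have UE : \bigcup_i A i = \bigcup_(i in [set` enum 'I_n]) A i.
  by apply/seteqP; split => x [i _ Aix]; exists i => //=; rewrite mem_enum.
rewrite -(chi_nerve_union Ac); split.
  apply/andP; split; last first.
    by rewrite UE -[X in Posz X](size_enum_ord n); exact: chi_union_le.
  have [->|UT] := pselect (\bigcup_i A i = setT); first by rewrite chi_setT.
  have [U0|/set0P U0] := eqVneq (\bigcup_i A i) set0.
    rewrite U0 chi_set0; apply: contraT; rewrite -ltNge => /ltW/A0.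
    by rewrite U0 => -[].
  exact/ltW/chi_proper_gt.
split=> [XU|chiU].
  suff -> : \bigcup_i A i = setT by exact: chi_setT.
  exact/seteqP.
apply: contrapT => nXU.
have UT : \bigcup_i A i <> setT by move=> E; apply: nXU; rewrite E.
have [U0|/set0P U0] := eqVneq (\bigcup_i A i) set0.
  move: chiU; rewrite U0 chi_set0 => G0.
  by have := A0; rewrite -G0 lexx U0 => /(_ isT)[].
by have := chi_proper_gt Xconn Xleaf Uc U0 UT; rewrite chiU ltxx.
Qed.

End good_coverings.

(** * Helly's theorem for small sets *)

Section helly.
Variables (R : realType) (G : multigraph R) (r : R).
Hypotheses (r0 : 0 < r) (rg : ((r * 6)%:E <= girth G)%E).
Local Notation X := (realization G).

(** In a ball of radius less than half the girth, counting the crossings of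
    short paths from the centre cuts every short cell. *)
Lemma small_has_cuts (D : edge G -> seq R) (F : set X) x0 : cellular D F ->
  (forall e p q, (e, p, q) \in cells D -> q - p < r) ->
  (forall x, F x -> ball x0 (r * 2) x) -> has_cuts D F.
Proof.
move=> Fc fine Fx0 c cin Fm.
set z := (c.1.2 + c.2) / 2.
have zin : 0 < z <= len c.1.1.
  case: c cin {Fm} @z => -[e p] q /cell_bounds[p0 pq ql] z.
  by have /andP[pz zq] := mid_in_cell pq; rewrite (le_lt_trans p0 pz) (le_trans (ltW zq)).
have r3g : ((r * 3 + r * 3)%:E <= girth G)%E.
  by apply: le_trans rg; rewrite lee_fin; lra.
(* The path to one end of a cell, followed by the cell, is shorter than 3 r. *)
exists (short_crossings c.1.1 z (r * 3) x0) => c' c'in Fm'.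
have [F1 F2] := cellular_ends Fc c'in Fm'.
have /ballP[s sP sr] := Fx0 _ F1.
have sr3 : seg_len s < r * 3 by apply: lt_trans sr _; rewrite ltr_pM2l// ltr_nat.
rewrite natz -(cross_cell cin c'in) (short_crossingsE zin r3g sP)//.
case: c' c'in {Fm'} F1 F2 sP => -[e p] q c'in F1 F2 sP.
have [p0 pq ql] := cell_bounds c'in.
have sP' : seg_path x0 (s ++ [:: (e, p, q)]) (pt e q).
  by apply: seg_path_cat sP _; split=> //=; lra.
rewrite (short_crossingsE zin r3g sP').
  by rewrite crossings_cat addrC addKr /crossings big_seq1.
rewrite seg_len_cat seg_len_cons {2}/seg_len big_nil addr0/= distrC gtr0_norm ?subr_gt0//.
by have := fine _ _ _ c'in; lra.
Qed.

Lemma fine_grid : exists D : edge G -> seq R, forall e (p q : R), 0 <= p -> q <= len e ->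
  r <= q - p -> exists2 t, t \in D e & p < t < q.
Proof.
pose h := r / 2; have h0 : 0 < h by rewrite divr_gt0.
exists (fun e => [seq k%:R * h | k <- iota 0 (Num.truncn (len e / h)).+2]) => e p q p0 ql rpq.
have phq : p + h < q by rewrite /h; have := r0; lra.
pose k := (Num.truncn (p / h)).+1.
have pk : p < k%:R * h by rewrite -ltr_pdivrMr// truncnS_gt.
have kp : k%:R * h <= p + h.
  by rewrite -natr1 mulrDl mul1r lerD2r -ler_pdivlMr// truncn_le divr_ge0// ltW.
exists (k%:R * h); last by rewrite pk/=; apply: le_lt_trans kp _.
apply/mapP; exists k => //; rewrite mem_iota add0n ltnS ltnS.
apply: le_truncn; rewrite ler_pM2r ?invr_gt0//; lra.
Qed.

Definition small (F : set X) := forall x y, F x -> F y -> ball x r y.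

(** If three sets met in pairs only, their union would have Euler
    characteristic 0; but it has cuts, so it is a forest. *)
Lemma helly_three (A B C : set X) : compact A -> compact B -> compact C ->
  contractible R A -> contractible R B -> contractible R C ->
  small A -> small B -> small C ->
  A `&` B !=set0 -> A `&` C !=set0 -> B `&` C !=set0 ->
  contractible R (A `&` B) -> contractible R (A `&` C) -> contractible R (B `&` C) ->
  A `&` B `&` C !=set0.
Proof.
move=> cA cB cC kA kB kC sA sB sC [x0 [Ax0 Bx0]] [x1 [Ax1 Cx1]] BC kAB kAC kBC.
have [D0 D0P] := fine_grid.
pose K (i : 'I_3) := nth A [:: A; B; C] i.
have K_closed i : closed (K i).
  by apply: compact_closed_realization; case: i => -[|[|[|]]].
have K_conn i : connected (K i).
  by apply: contractible_connected; case: i => -[|[|[|]]].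
have [D [D0D Kc]] := common_subdivision D0 K_closed K_conn.
have Ac : cellular D A by exact: (Kc ord0).
have Bc : cellular D B by exact: (Kc (@Ordinal 3 1 isT)).
have Cc : cellular D C by exact: (Kc (@Ordinal 3 2 isT)).
apply/set0P/negP => /eqP ABC0.
have compactI (F F' : set X) : compact F -> compact F' -> compact (F `&` F').
  move=> cF cF'; apply: (subclosed_compact _ cF) => //.
  by apply: closedI; exact: compact_closed_realization.
have e1 := chi_contractible cA kA Ac; have e2 := chi_contractible cB kB Bc.
have e3 := chi_contractible cC kC Cc.
have e4 := chi_contractible (compactI _ _ cA cB) kAB (cellularI Ac Bc).
have e5 := chi_contractible (compactI _ _ cA cC) kAC (cellularI Ac Cc).
have e6 := chi_contractible (compactI _ _ cB cC) kBC (cellularI Bc Cc).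
have u1 := chiUI D A B; have u2 := chiUI D (A `|` B) C.
have u3 := chiUI D (A `&` C) (B `&` C).
rewrite -setIUl (_ : A `&` C `&` (B `&` C) = set0) ?chi_set0 in u3; last first.
  by rewrite -ABC0; apply/seteqP; split => x; [move=> [[? ?] [? ?]]|move=> [[? ?] ?]].
suff : 1 <= chi D (A `|` B `|` C).
  by rewrite e1 e2 e4 in u1; rewrite e5 e6 in u3; rewrite e3 in u2; lia.
have Yc := cellularU (cellularU Ac Bc) Cc.
apply: chi_has_cuts => //; last by exists x0; left; left.
apply: (@small_has_cuts D _ x0) => //.
  move=> e p q cin; rewrite ltNge; apply/negP => rpq.
  have [p0 pq ql] := cell_bounds cin; have [t /D0D tD tpq] := D0P e p q p0 ql rpq.
  by have := cell_avoids cin tD; rewrite tpq.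
have near x : ball x0 r x -> ball x0 (r * 2) x by apply: le_ball; have := r0; lra.
move=> x [[Ax|Bx]|Cx]; [exact/near/sA|exact/near/sB|].
by rewrite mulrDr mulr1; apply: (ball_triangle (sA _ _ Ax0 Ax1)); exact: sC.
Qed.

(** Two sets of the list are replaced by their intersection, which meets every
    other set by the statement for three sets. *)
Lemma helly_seq (K : set (set X)) (l : seq (set X)) :
  (forall A B, K A -> K B -> K (A `&` B)) ->
  (forall A B C, K A -> K B -> K C -> A `&` B !=set0 -> A `&` C !=set0 ->
     B `&` C !=set0 -> A `&` B `&` C !=set0) ->
  (forall A, A \in l -> K A) ->
  (forall A B, A \in l -> B \in l -> A `&` B !=set0) ->
  l != [::] -> foldr setI setT l !=set0.
Proof.
move=> KI K3; have [m] := ubnP (size l); elim: m l => // m IH [//|A [|B l]] lm Kl l2 _.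
  by rewrite /= setIT -[A]setIid; apply: l2; exact: mem_head.
have Al : A \in [:: A, B & l] by exact: mem_head.
have Bl : B \in [:: A, B & l] by rewrite !inE eqxx orbT.
have ll C : C \in l -> C \in [:: A, B & l] by move=> Cl; rewrite !inE Cl !orbT.
have AB0 := l2 _ _ Al Bl.
have ABC C : C \in l -> A `&` B `&` C !=set0.
  by move=> /ll Cl; apply: K3; auto.
rewrite /= setIA -[X in X !=set0]/(foldr setI setT (A `&` B :: l)).
apply: IH => //.
- move=> C; rewrite inE => /predU1P[->|/ll]; last exact: Kl.
  by apply: KI; exact: Kl.
- move=> C C'; rewrite !inE => /predU1P[->|Cl] /predU1P[->|C'l].
  + by rewrite setIid.
  + exact: ABC.
  + by rewrite setIC; exact: ABC.
  + by apply: l2; exact: ll.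
Qed.

End helly.

Section small_coverings.
Variables (R : realType) (G : multigraph R) (n : nat).
Local Notation X := (realization G).
Variable A : 'I_n -> set X.
Hypothesis A_compact : forall i, compact (A i).
Hypothesis A_good : forall I : {set 'I_n}, I != finset.set0 ->
  inter A I !=set0 -> contractible R (inter A I).

(** The girth is infinite when there are no cycles, so a finite bound is needed. *)
Lemma common_radius : (forall i, (diam (A i) < (6^-1)%:E * girth G)%E) ->
  exists r : R, [/\ 0 < r, ((r * 6)%:E <= girth G)%E & forall i, (diam (A i) < r%:E)%E].
Proof.
move=> dA; have [m m0 mlen] := min_len G; have mg := girth_ge (ltW m0) mlen.
case E : (girth G) mg dA => [g| |] //= mg dA.
  have g0 : 0 < g by apply: lt_le_trans m0 _; rewrite -lee_fin.
  exists (g / 6); split => [||i]; first by rewrite divr_gt0.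
    by rewrite lee_fin divfK.
  by rewrite mulrC; exact: dA.
pose b i := Num.max 0 (fine (diam (A i))).
have b0 i : 0 <= b i by rewrite /b le_max lexx.
exists (1 + \sum_i b i); split => [||i]; first by rewrite ltr_wpDr// sumr_ge0.
  exact: leey.
have := dA i; rewrite gt0_muley ?lte_fin// => dAi.
apply: (@le_lt_trans _ _ (b i)%:E); last first.
  by rewrite lte_fin (bigD1 i)//= ltr_pwDl// lerDl sumr_ge0.
by rewrite /b; case: (diam (A i)) dAi => [x _|//|_] /=;
  rewrite ?leNye// lee_fin le_max lexx orbT.
Qed.

Lemma diam_small r (F : set X) : (diam F < r%:E)%E -> small r F.
Proof.
move=> dF x y Fx Fy; apply: (@edist_lt_ball _ _ r (x, y)).
by apply: le_lt_trans dF; apply: ereal_sup_ubound; exists (x, y).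
Qed.

(** The intersections of covering sets are closed under intersection and
    contractible when they are not empty, so that the statement for three sets
    applies to all of them. *)
Lemma pairwise_intersecting (I : {set 'I_n}) :
  (forall i, (diam (A i) < (6^-1)%:E * girth G)%E) -> I != finset.set0 ->
  (forall i j, i \in I -> j \in I -> A i `&` A j !=set0) -> inter A I !=set0.
Proof.
move=> /common_radius[r [r0 rg rA]] I0 pairs.
pose K (S : set X) := exists2 J : {set 'I_n}, J != finset.set0 & S = inter A J.
have interU (J J' : {set 'I_n}) : inter A J `&` inter A J' = inter A (J :|: J').
  apply/seteqP; split => [x [xJ xJ'] i /=|x xJJ'].
    by rewrite inE => /orP[/xJ|/xJ'].
  by split=> i /= iJ; apply: xJJ'; rewrite /= inE iJ ?orbT.
have KI S S' : K S -> K S' -> K (S `&` S').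
  move=> [J /set0Pn[i iJ] ->] [J' J'0 ->]; exists (J :|: J')%SET => //.
  by apply/set0Pn; exists i; rewrite inE iJ.
have Kc S : K S -> compact S by move=> [J J0 ->]; exact: inter_compact.
have Kk S : K S -> S !=set0 -> contractible R S by move=> [J J0 ->]; exact: A_good.
have Ks S : K S -> small r S.
  move=> [J /set0Pn[i iJ] ->] x y Jx Jy; apply: (diam_small (rA i)).
    exact: Jx.
  exact: Jy.
have -> : inter A I = foldr setI setT [seq A i | i <- enum I].
  have mem_fold (l : seq 'I_n) x : foldr setI setT [seq A i | i <- l] x <->
      forall i, i \in l -> A i x.
    elim: l => [|i l IH] /=; first by split.
    split => [[Aix /IH lx] j|lx]; first by rewrite inE => /predU1P[->//|/lx].
    by split; [apply: lx; exact: mem_head|apply/IH => j jl; apply: lx; rewrite inE jl orbT].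
  apply/seteqP; split => x.
    by move=> xI; apply/mem_fold => i; rewrite mem_enum => /xI.
  by move=> /mem_fold xI i /= iI; apply: xI; rewrite mem_enum.
apply: (@helly_seq _ G K) => //.
- move=> S T U KS KT KU ST SU TU.
  have nonempty_l (V V' : set X) : V `&` V' !=set0 -> V !=set0 by move=> [x []]; exists x.
  have nonempty_r (V V' : set X) : V `&` V' !=set0 -> V' !=set0 by move=> [x []]; exists x.
  by apply: (@helly_three R G r r0 rg) => //; auto; apply: Kk; eauto.
- move=> S /mapP[i iI ->]; exists [set i]%SET; last by rewrite inter_set1.
  by apply/set0Pn; exists i; rewrite inE.
- by move=> S T /mapP[i + ->] /mapP[j + ->]; rewrite !mem_enum; exact: pairs.
- by move: I0 => /set0Pn[i iI]; rewrite -size_eq0 size_map -cardE -lt0n card_gt0; apply/set0Pn; exists i.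
Qed.

(** Two vertices of a face are joined by an edge of the complex, and a vertex
    without edges is a top face. *)
Lemma flag_complex (s : {set {set 'I_n}}) :
  (forall i, (diam (A i) < (6^-1)%:E * girth G)%E) -> is_complex s ->
  (forall i, [set i]%SET \in top_faces s -> A i !=set0) ->
  (forall i j : 'I_n, (i < j)%N -> [set i; j]%SET \in s -> A i `&` A j !=set0) ->
  forall I, I \in s -> inter A I !=set0.
Proof.
move=> dA /is_complexP[s0 sP] isol edges I Is.
have edges' i j : i != j -> [set i; j]%SET \in s -> A i `&` A j !=set0.
  move=> ij ijs; case: (ltngtP i j) => [?|?|/val_inj E]; first exact: edges.
    by rewrite setIC; apply: edges => //; rewrite finset.setUC.
  by rewrite E eqxx in ij.
have ne2 (i j : 'I_n) : [set i; j]%SET != finset.set0.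
  by apply/set0Pn; exists i; rewrite !inE eqxx.
have single i : i \in I -> A i !=set0.
  move=> iI; have [[j [ij ijs]]|none] := pselect (exists j, i != j /\ [set i; j]%SET \in s).
    by have [x []] := edges' i j ij ijs; exists x.
  apply: isol; rewrite inE; apply/maxsetP; split.
    suff : [set i]%SET \in s by [].
    apply: sP Is _ _; last by rewrite finset.sub1set.
    by apply/set0Pn; exists i; rewrite inE.
  move=> B Bs; rewrite finset.sub1set => iB; apply/setP => j; rewrite inE.
  apply/idP/eqP => [jB|->//]; apply/eqP; apply/negPn/negP => ji.
  apply: none; exists j; rewrite eq_sym; split=> //; apply: sP Bs _ _ => //.
  by apply/fintype.subsetP => k; rewrite !inE => /orP[]/eqP ->.
apply: pairwise_intersecting => //; first by apply: contraNneq s0 => <-.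
move=> i j iI jI; have [->|ij] := eqVneq i j; first by rewrite setIid; exact: single.
apply: edges' => //; apply: sP Is _ _ => //.
by apply/fintype.subsetP => k; rewrite !inE => /orP[]/eqP ->.
Qed.

End small_coverings.

(** * Measurability *)

Section measurability.
Variables (R : realType) (G : multigraph R).
Local Notation X := (realization G).

Definition rational_point (q : vertex G + edge G * rat) : X :=
  match q with inl v => vpt v | inr (e, a) => pt e (ratr a) end.

Lemma rational_point_dense (x : X) r : 0 < r -> exists q, ball (rational_point q) r x.
Proof.
move=> r0; case: (point_cases x) => [[v ->]|[e [t [_ ->]]]].
  by exists (inl v); exact: ballxx.
have [|a] := @rat_in_itvoo R (t - r) (t + r); first by lra.
rewrite in_itv/= => /andP[a1 a2]; exists (inr (e, a)); apply: ball_pt.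
by rewrite ltr_norml; lra.
Qed.

Lemma harmonic_lt (r : R) : 0 < r -> exists k : nat, k.+1%:R^-1 < r.
Proof.
move=> r0; exists (Num.truncn r^-1); rewrite invf_plt ?posrE ?ltr0n//.
exact: truncnS_gt.
Qed.

Variables (d : measure_display) (W : measurableType d) (n : nat).
Variable A : 'I_n -> W -> hyperspace X.
Hypothesis A_random : random_covering A.
Implicit Types (I : {set 'I_n}).

Lemma covering_compact w i : compact (covering_at A w i).
Proof. by have /asboolP := valP (A i w). Qed.

Lemma covering_closed w i : closed (covering_at A w i).
Proof. by apply: compact_closed_realization; exact: covering_compact. Qed.

(** Meeting a ball is an open condition for the Hausdorff distance: a path from
    the centre that is shorter than the radius leaves room for a small move. *)
Lemma measurable_meets_ball i x r :
  measurable [set w | covering_at A w i `&` ball x r !=set0].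
Proof.
pose U : set (hyperspace X) := [set K | val K `&` ball x r !=set0].
have U_open : hausdorff_open U.
  move=> K [y [Ky /ballP[s sP sr]]] _; exists (r - seg_len s); first by rewrite subr_gt0.
  move=> L L0 KL.
  have : (edist_inf (val L) y < (r - seg_len s)%:E)%E.
    apply: le_lt_trans KL; rewrite /hausdorff_dist le_max; apply/orP; left.
    by apply: ereal_sup_ubound; exists y.
  move=> /ereal_inf_lt[_ [z Lz <-]] /edist_lt_ball /= yz.
  exists z; split=> //; rewrite -(subrK (seg_len s) r).
  move/ballP : yz => [s' s'P s'r]; apply/ballP; exists (s ++ s').
    exact: seg_path_cat sP s'P.
  by rewrite seg_len_cat addrC ltrD2r.
have mU : measurable (U : set (borel_hyperspace X)) by exact: sub_sigma_algebra.
have := A_random i measurableT mU.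
by rewrite setTI.
Qed.

(** A cluster point of the centres of the balls belongs to all sets; this gives
    the event by countable operations on events for single sets. *)
Lemma inter_meets_balls w I : I != finset.set0 -> inter (covering_at A w) I !=set0 <->
  forall k : nat, exists q, forall i, i \in I ->
    covering_at A w i `&` ball (rational_point q) k.+1%:R^-1 !=set0.
Proof.
move=> I0; split => [[x xI] k|H].
  have k0 : 0 < k.+1%:R^-1 :> R by rewrite invr_gt0 ltr0n.
  have [q qx] := rational_point_dense x k0; exists q => i iI.
  by exists x; split=> //; exact: xI.
pose x k := rational_point (sval (cid (H k))).
have xP k i : i \in I -> covering_at A w i `&` ball (x k) k.+1%:R^-1 !=set0.
  exact: svalP (cid (H k)) i.
have [|y [_ y_cluster]] := @realization_compact R G (x @ \oo) _; first exact: filterT.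
exists y => i /= iI; apply: contrapT => Niy.
have /nbhs_ballP[r /= r0 rP] : nbhs y (~` covering_at A w i).
  by apply: open_nbhs_nbhs; split=> //; apply: closed_openC; exact: covering_closed.
have r20 : 0 < r / 2 by rewrite divr_gt0.
have [k0 k0r] := harmonic_lt r20.
have tail : (x @ \oo) [set x k | k in [set k | (k0 <= k)%N]].
  by exists k0 => // k /= k0k; exists k.
have [_ [[k /= k0k <-] yxk]] := y_cluster _ _ tail (nbhsx_ballx y _ r20).
have [z [Az xz]] := xP k i iI.
apply: (rP z) Az; apply: ball_split yxk _; apply: le_ball xz.
by apply/ltW/(le_lt_trans _ k0r); rewrite lef_pV2 ?posrE ?ltr0n// ler_nat ltnS.
Qed.

Lemma measurable_inter I : I != finset.set0 ->
  measurable [set w | inter (covering_at A w) I !=set0].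
Proof.
move=> I0; rewrite (_ : [set _ | _] = \bigcap_k \bigcup_q \bigcap_(i in [set` I])
   [set w | covering_at A w i `&` ball (rational_point q) k.+1%:R^-1 !=set0]); last first.
  apply/seteqP; split => w /=.
    move=> /(inter_meets_balls w I0) H k _; have [q qP] := H k.
    by exists q.
  move=> H; apply/(inter_meets_balls w I0) => k; have [q _ qP] := H k Logic.I.
  by exists q => i iI; exact: qP.
apply: bigcapT_measurable => k; apply: countable_bigcupT_measurable; first exact: countableP.
move=> q; apply: fin_bigcap_measurable; first exact: finite_finset.
by move=> i _; exact: measurable_meets_ball.
Qed.

Lemma measurable_complete_coverage :
  measurable [set w | [set: X] `<=` \bigcup_i covering_at A w i].
Proof.
rewrite -[X in measurable X]setCK; apply: measurableC.
rewrite (_ : ~` _ = \bigcup_q \bigcup_(k in [set: nat]) \bigcap_(i in [set: 'I_n])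
   ~` [set w | covering_at A w i `&` ball (rational_point q) k.+1%:R^-1 !=set0]); last first.
  apply/seteqP; split => w /=.
    move=> /existsNP[x /not_implyP[_ Nx]].
    have /nbhs_ballP[r /= r0 rP] : nbhs x (~` \bigcup_(i in [set i | i \in enum 'I_n /\ True]) covering_at A w i).
      apply: open_nbhs_nbhs; split; last by move=> [i _ Aix]; apply: Nx; exists i.
      by apply: closed_openC; apply: closed_bigcup_seq => i _; exact: covering_closed.
    have r20 : 0 < r / 2 by rewrite divr_gt0.
    have [k kr] := harmonic_lt r20; have [q qx] := rational_point_dense x r20.
    exists q => //; exists k => // i _ [y [Aiy qy]]; apply: (rP y).
      apply: ball_split (ball_sym qx) _; apply: le_ball qy; exact: ltW.
    by exists i => //; split=> //; rewrite mem_enum.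
  move=> [q _ [k _ H]] /(_ (rational_point q) Logic.I)[i _ Ai].
  by apply: (H i Logic.I); exists (rational_point q); split=> //; apply: ballxx; rewrite invr_gt0 ltr0n.
apply: countable_bigcupT_measurable; first exact: countableP.
move=> q; apply: bigcup_measurable => k _.
apply: fin_bigcap_measurable; first exact: finite_finset.
by move=> i _; apply: measurableC; exact: measurable_meets_ball.
Qed.

Definition nerve_event (s : {set {set 'I_n}}) : set W := [set w | nerve (covering_at A w) = s].

Lemma mem_nerve w I : I \in nerve (covering_at A w) <->
  I != finset.set0 /\ inter (covering_at A w) I !=set0.
Proof.
by rewrite inE; split => [/andP[I0 /asboolP]//|[-> AI]]; apply/asboolP.
Qed.

Lemma measurable_nerve_event s : measurable (nerve_event s).
Proof.
rewrite (_ : nerve_event s = \bigcap_(I in [set: {set 'I_n}])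
   [set w | (I \in nerve (covering_at A w)) = (I \in s)]); last first.
  apply/seteqP; split => w /=; first by move=> <- I.
  by move=> H; apply/setP => I; exact: H.
apply: fin_bigcap_measurable; first exact: finite_finset.
move=> I _; have [I0|I0] := eqVneq I finset.set0.
  rewrite (_ : [set _ | _] = if I \in s then set0 else setT).
    by case: ifP => _; [exact: measurable0|exact: measurableT].
  apply/seteqP; rewrite I0; split => w /=; rewrite inE eqxx/=.
    by move=> <-.
  by case: ifP.
rewrite (_ : [set _ | _] = if I \in s then [set w | inter (covering_at A w) I !=set0]
   else ~` [set w | inter (covering_at A w) I !=set0]).
  by case: ifP => _; [|apply: measurableC]; exact: measurable_inter.
apply/seteqP; split => w /=.
  case: ifPn => Is; first by move/mem_nerve => [].
  by move=> nI AI; have /mem_nerve := conj I0 AI; rewrite nI.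
case: ifPn => Is; first by move=> AI; apply/mem_nerve.
by move=> nAI; apply/negbTE/negP => /mem_nerve[].
Qed.

End measurability.

(** * The distribution of the nerve *)

Section almost_sure.
Variables (R : realType) (d : measure_display) (W : measurableType d) (P : probability W R).

Lemma ae_eq_probability (B C : set W) : measurable B -> measurable C ->
  {ae P, forall w, B w <-> C w} -> P B = P C.
Proof.
move=> mB mC [N [mN N0 BCN]].
have le (B' C' : set W) : measurable B' -> measurable C' ->
    (forall w, ~ (B w <-> C w) \/ (B' w -> C' w)) -> (P B' <= P C')%E.
  move=> mB' mC' H; apply: (@le_trans _ _ (P (C' `|` N))).
    apply: le_measure; rewrite ?inE//; first exact: measurableU.
    move=> w Bw; have [nBC|BC] := H w; last by left; exact: BC.
    by right; exact: BCN.
  by rewrite -[leRHS]adde0 -[X in (_ <= _ + X)%E]N0; exact: measureU2.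
apply/eqP; rewrite eq_le; apply/andP; split; apply: le => // w;
  by have [[? ?]|?] := pselect (B w <-> C w); [right|left].
Qed.

Lemma ae_forall_fin (I : finType) (Q : I -> W -> Prop) :
  (forall i, {ae P, forall w, Q i w}) -> {ae P, forall w i, Q i w}.
Proof.
move=> aeQ; suff : {ae P, forall w, forall i, i \in enum I -> Q i w}.
  by apply: filterS => w H i; apply: H; rewrite mem_enum.
elim: (enum I) => [|i s IH]; first exact: filterE.
apply: filterS2 (aeQ i) IH => w Qi Qs j.
by rewrite inE => /predU1P[->|/Qs].
Qed.

Lemma ae_imply (C : Prop) (Q : W -> Prop) :
  (C -> {ae P, forall w, Q w}) -> {ae P, forall w, C -> Q w}.
Proof.
have [c|nc] := pselect C; first by move=> /(_ c); apply: filterS.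
by move=> _; apply: filterE.
Qed.

End almost_sure.

Section nerve_distribution.
Variables (R : realType) (G : multigraph R).
Local Notation X := (realization G).
Variables (d : measure_display) (W : measurableType d) (P : probability W R) (n : nat).
Variable A : 'I_n -> W -> hyperspace X.
Hypothesis A_random : random_covering A.

Lemma P_eq_nerve (s : {set {set 'I_n}}) : is_complex s -> P_eq P A s = P (nerve_event A s).
Proof.
move=> /is_complexP[s0 _]; rewrite /P_eq; congr (P _); apply/seteqP; split => w /=.
  move=> [H1 H2]; apply/setP => I; apply/idP/idP.
    move=> /mem_nerve[I0 AI]; apply: contraT => /(H2 _ I0) E.
    by move: AI; rewrite E => -[].
  move=> Is; apply/mem_nerve; split; last exact: H1.
  by apply: contraNneq s0 => <-.
move=> <-; split => [I /mem_nerve[]//|J J0 nJ].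
by apply/eqP; apply/negPn/negP => /set0P AJ; move/negP: nJ; apply; apply/mem_nerve.
Qed.

Lemma p_sub_nerve (s : {set {set 'I_n}}) : is_complex s ->
  p_sub P A s = P [set w | s \subset nerve (covering_at A w)].
Proof.
move=> /is_complexP[s0 _]; rewrite /p_sub; congr (P _); apply/seteqP; split => w /=.
  move=> H; apply/fintype.subsetP => I Is; apply/mem_nerve; split; last exact: H.
  by apply: contraNneq s0 => <-.
by move=> /fintype.subsetP H I /H /mem_nerve[].
Qed.

Lemma measurable_nerve_pred (Q : pred {set {set 'I_n}}) :
  measurable [set w | Q (nerve (covering_at A w))].
Proof.
rewrite (_ : [set _ | _] = \bigcup_(s in [set s | Q s]) nerve_event A s).
  apply: fin_bigcup_measurable; first exact: finite_finset.
  by move=> s _; exact: measurable_nerve_event.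
apply/seteqP; split => w /=; first by move=> Qw; exists (nerve (covering_at A w)).
by move=> [s Qs]; rewrite /nerve_event/= => ->.
Qed.

(** The event is the disjoint union of the events that the nerve is a given
    complex. *)
Lemma probability_nerve_pred (Q : pred {set {set 'I_n}}) :
  P [set w | Q (nerve (covering_at A w))] =
  (\sum_(s : {set {set 'I_n}} | is_complex s && Q s) P_eq P A s)%E.
Proof.
have partial (l : seq {set {set 'I_n}}) : uniq l ->
    P [set w | nerve (covering_at A w) \in [seq s <- l | is_complex s && Q s]] =
    (\sum_(s <- l | is_complex s && Q s) P_eq P A s)%E.
  elim: l => [_|s l IH /= /andP[sl l_uniq]].
    by rewrite big_nil (_ : [set _ | _] = set0) ?measure0// -subset0 => w.
  rewrite big_cons; case: ifP => [/andP[cs Qs]|_]; last exact: IH.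
  rewrite -IH// P_eq_nerve// -measureU.
  - congr (P _); apply/seteqP; split => w /=.
      by rewrite inE => /predU1P[|]; [left|right].
    by rewrite inE => -[->|->]; rewrite ?eqxx ?orbT.
  - exact: measurable_nerve_event.
  - exact: (measurable_nerve_pred (fun N => N \in [seq s <- l | is_complex s && Q s])).
  - rewrite -subset0 => w /= [ws]; rewrite mem_filter.
    by have -> : nerve (covering_at A w) = s := ws; rewrite (negbTE sl) andbF.
rewrite -partial ?index_enum_uniq//; congr (P _); apply/seteqP; split => w /=.
  by rewrite mem_filter mem_index_enum andbT nerve_is_complex => ->.
by rewrite mem_filter => /andP[/andP[]].
Qed.

Lemma P_eq_fin_num s : is_complex s -> P_eq P A s \is a fin_num.
Proof. by move=> cs; rewrite P_eq_nerve// fin_num_measure//; exact: measurable_nerve_event. Qed.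

(** The probabilities of the subcomplex events determine the distribution of
    the Euler characteristic of the nerve: its indicator at the lower end of the
    range is the Lagrange polynomial, whose powers are expanded over complexes. *)
Lemma sum_a_coef (lo hi : int) :
  {ae P, forall w, lo <= chi_nerve A w <= hi} ->
  (\sum_(s : {set {set 'I_n}} | is_complex s && (faces_euler s == lo)) P_eq P A s =
   \sum_(s : {set {set 'I_n}} | is_complex s) (a_coef lo hi s)%:E * p_sub P A s)%E.
Proof.
move=> range; pose pr s := fine (P_eq P A s).
have prE s : is_complex s -> P_eq P A s = (pr s)%:E by move=> cs; rewrite fineK// P_eq_fin_num.
have pr0 t : is_complex t -> ~~ (lo <= faces_euler t <= hi) -> pr t = 0.
  move=> ct nt; rewrite /pr P_eq_nerve// (_ : P _ = 0%E)//.
  apply/negligibleP; first exact: measurable_nerve_event.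
  apply: negligibleS range => w /= wt; move/negP : nt; apply: contra_not.
  by rewrite /chi_nerve wt.
transitivity ((\sum_(t : {set {set 'I_n}} | is_complex t)
    pr t * \sum_(s : {set {set 'I_n}} | is_complex s && (s \subset t)) a_coef lo hi s)%:E)%E.
  rewrite -sumEFin big_mkcondr/=; apply: eq_bigr => t ct.
  have -> : \sum_(s : {set {set 'I_n}} | is_complex s && (s \subset t)) a_coef lo hi s =
      \sum_(0 <= k < (range_len lo hi).+1) v_coef lo hi k * (faces_euler t)%:~R ^+ k :> R.
    rewrite exchange_big/=; apply: eq_bigr => k _; rewrite -mulr_sumr; congr (_ * _).
    by rewrite -rmorph_sum/= sum_c_coef// rmorphXn.
  have [tr|tr] := boolP (lo <= faces_euler t <= hi); last first.
    by rewrite pr0// mul0r; case: ifP => // _; rewrite prE// pr0.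
  rewrite v_coef_indicator//; case: eqP => _; last by rewrite mulr0.
  by rewrite mulr1 prE.
under [RHS]eq_bigr => s cs.
  rewrite p_sub_nerve// (probability_nerve_pred (fun N => s \subset N)).
  rewrite (eq_bigr (fun t => (pr t)%:E)); last by move=> t /andP[ct _]; exact: prE.
  rewrite sumEFin -EFinM.
  over.
rewrite sumEFin; congr (_%:E).
under eq_bigr do rewrite mulr_sumr.
under [RHS]eq_bigr do rewrite mulr_sumr.
rewrite (exchange_big_dep (fun s => is_complex s))/=; last by move=> ? ? _ /andP[].
apply: eq_bigr => s cs; apply: eq_big => [t|t _]; last exact: mulrC.
by rewrite cs.
Qed.

End nerve_distribution.

(** * Complete coverage *)

(* The premises A_nonempty and A_isolated only concern the value set0 of the  *)
(* covering sets. Without them the conclusions they guard can fail: an empty  *)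
(* union on the circle has Euler characteristic 0 = chi(X), and an empty set  *)
(* at an isolated vertex of s is not detected by the edges of s.              *)
Theorem theorem1p1 (R : realType) (G : multigraph R)
  (X_nonempty : [set: realization G] !=set0)
  (X_connected : connected [set: realization G])
  (X_boundary : leaves G = finset.set0)
  (d : measure_display) (W : measurableType d) (P : probability W R)
  (n : nat) (A : 'I_n -> W -> hyperspace (realization G))
  (A_random : random_covering A)
  (A_good : good_covering P A) :
  (forall A_nonempty : (0 <= graph_euler G ->
     {ae P, forall w, \bigcup_i covering_at A w i !=set0}),
   [/\ {ae P, forall w, graph_euler G <= chi_nerve A w <= n%:Z},
       P [set w | [set: realization G] `<=` \bigcup_i covering_at A w i] =
         P [set w | chi_nerve A w = graph_euler G],
       P [set w | chi_nerve A w = graph_euler G] =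
         (\sum_(s : {set {set 'I_n}}
                | is_complex s && (faces_euler s == graph_euler G))
            P_eq P A s)%E &
       (\sum_(s : {set {set 'I_n}}
              | is_complex s && (faces_euler s == graph_euler G))
          P_eq P A s =
        \sum_(s : {set {set 'I_n}} | is_complex s)
          (a_coef (graph_euler G) n%:Z s)%:E * p_sub P A s)%E]) /\
  ((forall i, {ae P, forall w,
      (diam (covering_at A w i) < (6^-1)%:E * girth G)%E}) ->
   forall s : {set {set 'I_n}}, is_complex s ->
   forall A_isolated : (forall i : 'I_n, [set i]%SET \in top_faces s ->
      {ae P, forall w, covering_at A w i !=set0}),
   p_sub P A s =
     P [set w | forall i j : 'I_n, (i < j)%N -> [set i; j]%SET \in s ->
          covering_at A w i `&` covering_at A w j !=set0]).
Proof.
have chi_event : [set w | chi_nerve A w = graph_euler G] =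
    [set w | (fun N => faces_euler N == graph_euler G) (nerve (covering_at A w))].
  by apply/seteqP; split => w /= /eqP.
split => [A_nonempty|A_small s cs A_isolated].
  have key : {ae P, forall w, graph_euler G <= chi_nerve A w <= n%:Z /\
      ([set: realization G] `<=` \bigcup_i covering_at A w i <->
       chi_nerve A w = graph_euler G)}.
    apply: filterS2 A_good (ae_imply A_nonempty) => w good nonempty.
    by apply: nerve_euler_range => // i; exact: covering_compact.
  have range : {ae P, forall w, graph_euler G <= chi_nerve A w <= n%:Z}.
    by apply: filterS key => w [].
  split=> //; last exact: sum_a_coef.
    apply: ae_eq_probability.
    - exact: measurable_complete_coverage.
    - rewrite chi_event.
      exact: (measurable_nerve_pred A_random (fun N => faces_euler N == graph_euler G)).
    - by apply: filterS key => w [].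
  rewrite chi_event.
  exact: (probability_nerve_pred P A_random (fun N => faces_euler N == graph_euler G)).
have [s0 sP] := is_complexP _ cs.
have ne2 (i j : 'I_n) : [set i; j]%SET != finset.set0.
  by apply/set0Pn; exists i; rewrite !inE eqxx.
have inter2 w (i j : 'I_n) : inter (covering_at A w) [set i; j]%SET =
    covering_at A w i `&` covering_at A w j.
  apply/seteqP; split => x /=.
    by move=> xI; split; apply: xI; rewrite /= !inE eqxx ?orbT.
  by move=> [xi xj] k; rewrite /= !inE => /orP[]/eqP ->.
rewrite p_sub_nerve//; apply: ae_eq_probability.
- exact: (measurable_nerve_pred A_random (fun N => s \subset N)).
- pose Q : pred {set {set 'I_n}} := fun N => [forall i : 'I_n, forall j : 'I_n,
    (i < j)%N && ([set i; j]%SET \in s) ==> ([set i; j]%SET \in N)].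
  rewrite [X in measurable X](_ : _ = [set w | Q (nerve (covering_at A w))]).
    exact: (measurable_nerve_pred A_random Q).
  apply/seteqP; split => w /=.
    move=> H; apply/forallP => i; apply/forallP => j; apply/implyP => /andP[ij ijs].
    by apply/mem_nerve; rewrite inter2; split=> //; exact: H.
  move=> /forallP H i j ij ijs; have /forallP/(_ j) := H i.
  by rewrite ij ijs/= => /mem_nerve[_]; rewrite inter2.
have isol : {ae P, forall w i, [set i]%SET \in top_faces s -> covering_at A w i !=set0}.
  by apply: ae_forall_fin => i; exact: ae_imply (A_isolated i).
have small := ae_forall_fin A_small.
apply: filterS3 A_good isol small => w good isolw smallw.
split => [/fintype.subsetP sN i j _ ijs|pairs].
  by have /mem_nerve[_] := sN _ ijs; rewrite inter2.
apply/fintype.subsetP => I Is; apply/mem_nerve; split; first by apply: contraNneq s0 => <-.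
by apply: (flag_complex _ good smallw cs isolw pairs) => // i; exact: covering_compact.
Qed.
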